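(* Let $\alpha\in(0,1)$, $0<\lambda\le\Lambda$, let $\Omega\subset\mathbb{R}^n_+=\{x_n>0\}$ be a convex domain with $0\in\partial\Omega$, and let $u:\overline{\Omega}\to\mathbb{R}$ be a convex, continuous solution to $$\det D^2u=f\ \text{ in }\Omega,\qquad u=\varphi\ \text{ on }\partial\Omega,$$ where $\lambda\le f\le\Lambda$ in $\Omega$. Assume that $\Omega$ is uniformly convex at $0$, and that on $\partial\Omega$ near $0$ we have $$|x_n-q(x')|\le M|x'|^{2+\alpha},\qquad |\varphi(x)-p(x')|\le M|x'|^{2+\alpha},$$ where $p(x'),q(x')$ are quadratic polynomials and $$M\ge\max\{\|\nabla p(0)\|,\ \|D^2_{x'}p\|,\ \|D^2_{x'}q\|\}.$$ Then $$u(x)-u(0)-\nabla u(0)\cdot x\le C|x|^{1+\delta_0}\qquad\text{for } x\in\overline\Omega,$$ where $\delta_0>0$ depends only on $n$ and $\alpha$, and the constant $C>0$ depends only on $n,\lambda,\Lambda,\alpha,M$, the uniform convexity of $\partial\Omega$ at $0$, and $\|\varphi\|_{L^\infty(\partial\Omega)}$.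
   Context: Points of $\mathbb{R}^n$ are written $x=(x',x_n)$ with $x'\in\mathbb{R}^{n-1}$. Solutions of $\det D^2u=f$ are understood in the Alexandrov sense. A quadratic polynomial is a polynomial of degree at most $2$ (linear and constant terms allowed). Uniform convexity at $0$ (for $\Omega\subset\mathbb{R}^n_+$ convex, $0\in\partial\Omega$): there is $\kappa>0$ such that $x_n\ge\kappa|x|^2$ for all $x\in\partial\Omega$; dependence on the uniform convexity of $\partial\Omega$ at $0$ means dependence on $\kappa$. Gradient at a boundary point: for $x_0\in\partial\Omega$, $\nabla u(x_0)$ is understood in the sense that $x_{n+1}=u(x_0)+\nabla u(x_0)\cdot(x-x_0)$ is a supporting hyperplane for the graph of $u$ at $x_0$, but for any $\epsilon>0$, $x_{n+1}=u(x_0)+(\nabla u(x_0)+\epsilon\nu_{x_0})\cdot(x-x_0)$ is not a supporting hyperplane, where $\nu_{x_0}$ is the unit inner normal to $\partial\Omega$ at $x_0$ (here $\nu_0=e_n$).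
   Formalization: The constant C is also allowed to depend on the radius ρ of the neighbourhood of 0 in which the two pinching conditions on ∂Ω hold; without this the estimate fails (unit disk, φ = 0 for |x'| < ρ and φ = −1 beyond 2ρ, with ρ → 0). *)

(* Defs.v *)
From HB Require Import structures.
From mathcomp Require Import all_boot all_order all_algebra.
From mathcomp Require Import all_classical all_reals all_analysis.
(* The notations of mpoly clash with those of mathcomp-analysis. *)
From mathcomp.multinomials Require Import -(notations) mpoly.

Set Implicit Arguments.
Unset Strict Implicit.
Unset Printing Implicit Defensive.
Import Order.TTheory GRing.Theory Num.Theory numFieldNormedType.Exports.

Local Open Scope classical_set_scope.
Local Open Scope ring_scope.

(* The library norm `|x| on 'rV[R]_n is the sup norm; it is used below only
   through the topology it induces. *)
Definition dotv (R : realType) (n : nat) (x y : 'rV[R]_n) : R :=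
  \sum_(i < n) x 0 i * y 0 i.

Definition enorm (R : realType) (n : nat) (x : 'rV[R]_n) : R :=
  Num.sqrt (dotv x x).

Definition opnorm (R : realType) (n : nat) (A : 'M[R]_n) : R :=
  sup [set enorm (v *m A) | v in [set v : 'rV[R]_n | enorm v <= 1]].

(* A point of R^n, n = m.+1, is x = (x', x_n). *)
Definition xprime (R : realType) (m : nat) (x : 'rV[R]_m.+1) : 'rV[R]_m :=
  col' ord_max x.

Definition xlast (R : realType) (m : nat) (x : 'rV[R]_m.+1) : R := x 0 ord_max.

Definition e_last (R : realType) (m : nat) : 'rV[R]_m.+1 := delta_mx 0 ord_max.

Definition peval (R : realType) (m : nat) (p : mpoly m R) (y : 'rV[R]_m) : R :=
  meval (fun i => y 0 i) p.

Definition pgrad (R : realType) (m : nat) (p : mpoly m R) (y : 'rV[R]_m) :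
    'rV[R]_m :=
  \row_i peval (mderiv i p) y.

Definition phess (R : realType) (m : nat) (p : mpoly m R) (y : 'rV[R]_m) :
    'M[R]_m :=
  \matrix_(i, j) peval (mderiv i (mderiv j p)) y.

(* msize is the total degree plus one. *)
Definition quadratic (R : realType) (m : nat) (p : mpoly m R) : Prop :=
  (msize p <= 3)%N.

Definition boundary (T : topologicalType) (A : set T) : set T :=
  closure A `\` interior A.

Section lebesgue.
Context (R : realType) (m : nat).
Local Notation V := 'rV[R]_m.+1.
Local Open Scope ereal_scope.

Definition box (c : V * V) : set V :=
  [set x | forall i, (c.1 0 i <= x 0 i <= c.2 0 i)%R].

Definition box_volume (c : V * V) : R :=
  (\prod_(i < m.+1) Num.max 0 (c.2 0 i - c.1 0 i))%R.

Definition box_cover (X : set V) : set (nat -> V * V) :=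
  [set c | X `<=` \bigcup_k box (c k)].

Definition lebesgue_outer (X : set V) : \bar R :=
  ereal_inf [set \sum_(k <oo) (box_volume (c k))%:E | c in box_cover X].

Lemma box_volume_ge0 c : 0 <= (box_volume c)%:E.
Proof. by rewrite lee_fin; apply: prodr_ge0 => i _; rewrite le_max lexx. Qed.

Lemma lebesgue_outer_ge0 X : 0 <= lebesgue_outer X.
Proof.
apply: le_ereal_inf_tmp => _ [c _ <-].
by apply: nneseries_ge0 => n _ _; exact: box_volume_ge0.
Qed.

Lemma lebesgue_outer0 : lebesgue_outer set0 = 0.
Proof.
apply/eqP; rewrite eq_le lebesgue_outer_ge0 andbT.
apply: ereal_inf_lbound; exists (fun=> (0, 0)%R); first exact: sub0set.
by apply: eseries0 => n _ _; rewrite /box_volume big_ord_recl/= subrr maxxx mul0r.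
Qed.

Lemma le_lebesgue_outer :
  {homo lebesgue_outer : A B / A `<=` B >-> A <= B}.
Proof.
move=> A B AB; apply/ereal_inf_le_tmp => _ [c Bc <-]; exists c => //.
exact: subset_trans Bc.
Qed.

Lemma lebesgue_outer_sigma_subadditive : sigma_subadditive lebesgue_outer.
Proof.
move=> A; have [[i ioo]|] := pselect (exists i, lebesgue_outer (A i) = +oo).
  rewrite (eseries_pinfty _ _ ioo) ?leey// => n _.
  by rewrite -ltNye (lt_le_trans _ (lebesgue_outer_ge0 _)).
rewrite -forallNE => Aoo.
suff add2e (e : {posnum R}) : lebesgue_outer (\bigcup_n A n) <=
    \sum_(i <oo) lebesgue_outer (A i) + e%:num%:E.
  by apply/lee_addgt0Pr => _/posnumP[].
rewrite (le_trans _ (epsilon_trick _ _ _))//; last first.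
  by move=> n; exact: lebesgue_outer_ge0.
pose mu c := (box_volume c)%:E : \bar R.
pose P n (B : nat -> V * V) := box_cover (A n) B /\
  \sum_(k <oo) mu (B k) <= lebesgue_outer (A n) + (e%:num / (2 ^ n.+1)%:R)%:E.
have [G PG] : {G : nat -> nat -> V * V & forall n, P n (G n)}.
  apply: (@choice _ _ P) => n; rewrite /P /lebesgue_outer.
  set S := (X in ereal_inf X); move infS : (ereal_inf S) => iS.
  case: iS infS => [r Sr|Soo|Soo].
  - have en1 : (0 < e%:num / (2 ^ n.+1)%:R)%R by [].
    have /(lb_ereal_inf_adherent en1) : ereal_inf S \is a fin_num by rewrite Sr.
    move=> [x [B AnB muBx] xS].
    by exists B; split => //; rewrite muBx -Sr; exact/ltW.
  - by have := Aoo n; rewrite /lebesgue_outer Soo.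
  - suff : lbound S 0 by move/le_ereal_inf_tmp; rewrite Soo.
    move=> /= _ [B AnB <-]; apply: nneseries_ge0 => k _ _.
    exact: box_volume_ge0.
have muG_ge0 x : 0 <= (mu \o uncurry G) x by exact: box_volume_ge0.
apply: (@le_trans _ _ (\esum_(i in setT) (mu \o uncurry G) i)).
  rewrite /lebesgue_outer; apply: ereal_inf_lbound => /=.
  have /card_esym/ppcard_eqP[f] := card_nat2.
  exists (uncurry G \o f).
    move=> t [n _ /(PG n).1[k _ Gt]].
    by exists (f^-1%FUN (n, k)) => //=; rewrite invK ?inE.
  rewrite -(esum_pred_image (mu \o uncurry G) _ xpredT) ?[fun=> _]set_true//.
  by rewrite image_eq.
rewrite (_ : esum _ _ = \sum_(i <oo) \sum_(j <oo ) mu (G i j)); last first.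
  pose J : nat -> set (nat * nat) := fun i => [set (i, j) | j in setT].
  rewrite (_ : setT = \bigcup_k J k); last first.
    by rewrite predeqE => -[a b]; split => // _; exists a => //; exists b.
  rewrite esum_bigcupT /=; last 2 first.
    - apply/trivIsetP => i j _ _ ij.
      rewrite predeqE => -[n k] /=; split => //= -[] [_] _ [<-{n} _].
      by move=> [k' _] [] /esym/eqP; rewrite (negbTE ij).
    - by move=> /= [n k]; exact: box_volume_ge0.
  rewrite -(image_id [set: nat]) -fun_true esum_pred_image//; last first.
    by move=> n _; apply: esum_ge0 => ? _; exact: box_volume_ge0.
  apply: eq_eseriesr => /= j _.
  rewrite -(esum_pred_image (mu \o uncurry G) (pair j) predT)//=; last 2 first.
    - by move=> ? _; exact: box_volume_ge0.
    - by move=> ? ? _ _; exact: (@can_inj _ _ _ snd).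
  by congr esum; rewrite predeqE => -[a b]; split; move=> [i _ <-]; exists i.
apply: lee_lim.
- apply: is_cvg_nneseries => n *.
  by apply: nneseries_ge0 => k *; exact: (muG_ge0 (n, k)).
- apply: is_cvg_nneseries => n *; apply: adde_ge0 => //.
  exact: lebesgue_outer_ge0.
- by near=> n; apply: lee_sum => i _; exact: (PG i).2.
Unshelve. all: by end_near. Qed.

HB.instance Definition _ := isOuterMeasure.Build R V lebesgue_outer
  lebesgue_outer0 lebesgue_outer_ge0 le_lebesgue_outer
  lebesgue_outer_sigma_subadditive.

Definition lebesgue_outer_measure : {outer_measure set V -> \bar R} :=
  lebesgue_outer.

(* R^n with the sigma-algebra of Lebesgue (= Caratheodory) measurable sets *)
Definition lebesgue_space : measurableType _ :=
  caratheodory_type lebesgue_outer_measure.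

Definition lebesgue_rV : {measure set lebesgue_space -> \bar R} :=
  (lebesgue_outer_measure : set (caratheodory_type lebesgue_outer_measure) -> \bar R).

End lebesgue.

Arguments lebesgue_space : clear implicits.
Arguments lebesgue_rV : clear implicits.

Definition subdifferential (R : realType) (m : nat) (Omega : set 'rV[R]_m.+1)
    (u : 'rV[R]_m.+1 -> R) (x : 'rV[R]_m.+1) : set 'rV[R]_m.+1 :=
  [set p | forall y, Omega y -> u x + dotv p (y - x) <= u y].

(* Images of Borel sets under the subdifferential of a convex function are
   Lebesgue measurable, so the outer measure is their Lebesgue measure. *)
Definition monge_ampere (R : realType) (m : nat) (Omega : set 'rV[R]_m.+1)
    (u : 'rV[R]_m.+1 -> R) (E : set 'rV[R]_m.+1) : \bar R :=
  lebesgue_outer (\bigcup_(x in E) subdifferential Omega u x).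

Definition alexandrov_solution (R : realType) (m : nat)
    (Omega : set 'rV[R]_m.+1) (u f : 'rV[R]_m.+1 -> R) : Prop :=
  measurable_fun (Omega : set (lebesgue_space R m))
    (f : lebesgue_space R m -> R) /\
  forall E : set 'rV[R]_m.+1, <<s open >> E -> E `<=` Omega ->
    monge_ampere Omega u E = (\int[lebesgue_rV R m]_(x in E) (f x)%:E)%E.

Definition uniformly_convex_at0 (R : realType) (m : nat) (kappa : R)
    (Omega : set 'rV[R]_m.+1) : Prop :=
  forall x, boundary Omega x -> kappa * enorm x ^+ 2 <= xlast x.

Definition supporting (R : realType) (m : nat) (Omega : set 'rV[R]_m.+1)
    (u : 'rV[R]_m.+1 -> R) (x0 g : 'rV[R]_m.+1) : Prop :=
  forall x, closure Omega x -> u x0 + dotv g (x - x0) <= u x.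

(* g is the gradient of u at the boundary point x0, where nu is the unit inner
   normal to the boundary at x0 *)
Definition boundary_gradient (R : realType) (m : nat) (Omega : set 'rV[R]_m.+1)
    (u : 'rV[R]_m.+1 -> R) (x0 nu g : 'rV[R]_m.+1) : Prop :=
  supporting Omega u x0 g /\
  forall eps : R, 0 < eps -> ~ supporting Omega u x0 (g + eps *: nu).

(* Main.v *)
(* Subtract the tangent plane: v = u - u(0) - g.x >= 0, and on the boundary
   v = F(x') + O(|x'|^(2+alpha)) with F a quadratic form.  Put a = v(t e_n)/t; the
   point is that a <= C t^delta.  By convexity along the horizontal chord through
   t e_n, F >= (a kappa/2) |x'|^2 as soon as t^(alpha/2) << a.  Convexity also
   propagates the bound v >= a t at t e_n to v >= a h/2 on the whole slice
   {x_n = h}, with h comparable to t/a^2: first along the chord at height t, then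
   along rays from 0.  If h << a^n, the paraboloid eps x_n + b |x'|^2 + A x_n^2 with
   b ~ eps ~ a and A = eps/h has Hessian determinant > Lambda and lies below v on
   the boundary of the slab {x_n < h}; the comparison principle then gives
   v >= eps x_n, against the maximality of the normal slope of g.  Hence t is
   bounded below by a power of a.  The other points are reached along horizontal
   segments from the x_n axis to the boundary, where v = O(|x'|^2).

   The same comparison, on the whole of Omega, gives an affine lower barrier at 0,
   hence the existence of g and a bound for its normal slope.  In dimension 1
   there are no horizontal chords (and Omega may be a half-line), but the
   comparison on {x_n < h} alone gives the growth with exponent 2. *)

Require Import Defs.
From HB Require Import structures.
From mathcomp Require Import all_boot all_order all_algebra.
From mathcomp Require Import all_classical all_reals all_analysis.
From mathcomp.multinomials Require Import -(notations) mpoly.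
From mathcomp Require Import measurable_realfun ring lra.
Import Order.TTheory GRing.Theory Num.Theory numFieldNormedType.Exports.
Local Open Scope classical_set_scope.
Local Open Scope ring_scope.

Set Implicit Arguments.
Unset Strict Implicit.
Unset Printing Implicit Defensive.

(** * Coordinates (x', x_n) *)

(** On the boundary x_n is itself Q(x') + O(|x'|^(2+alpha)) once the linear part of q is known to
    vanish, so the form in question is F = P - g_n Q, where P and Q are the quadratic parts of p and
    q. Hence g has to be controlled before the growth argument starts: its tangential part is the
    linear part of p, and a bound on g_n enters every later constant.

    Two smallness conditions compete for the exponent: h^theta against a, with theta = alpha/2, and
    h against a^n. Instead of optimising, the single requirement t <= cs a^beta with beta = n + 2 +
    1/theta grants both, and delta0 = 1/beta.

    All barriers have a diagonal Hessian. Their gradient maps send boxes to boxes, so the comparison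
    principle only needs the scaling of the outer measure under such maps and the fact that open
    sets have positive measure. *)

Section coordinates.
Context (R : realType).

Lemma dotvC (n : nat) (x y : 'rV[R]_n) : dotv x y = dotv y x.
Proof. by apply: eq_bigr => i _; rewrite mulrC. Qed.

Lemma dotvDr (n : nat) (x y z : 'rV[R]_n) : dotv x (y + z) = dotv x y + dotv x z.
Proof. by rewrite -big_split; apply: eq_bigr => i _; rewrite mxE mulrDr. Qed.

Lemma dotvDl (n : nat) (x y z : 'rV[R]_n) : dotv (x + y) z = dotv x z + dotv y z.
Proof. by rewrite dotvC dotvDr !(dotvC z). Qed.

Lemma dotvZr (n : nat) (t : R) (x y : 'rV[R]_n) : dotv x (t *: y) = t * dotv x y.
Proof. by rewrite /dotv mulr_sumr; apply: eq_bigr => i _; rewrite mxE; ring. Qed.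

Lemma dotvZl (n : nat) (t : R) (x y : 'rV[R]_n) : dotv (t *: x) y = t * dotv x y.
Proof. by rewrite dotvC dotvZr dotvC. Qed.

Lemma dotvNr (n : nat) (x y : 'rV[R]_n) : dotv x (- y) = - dotv x y.
Proof. by rewrite -scaleN1r dotvZr mulN1r. Qed.

Lemma dotvNl (n : nat) (x y : 'rV[R]_n) : dotv (- x) y = - dotv x y.
Proof. by rewrite dotvC dotvNr dotvC. Qed.

Lemma dotvBr (n : nat) (x y z : 'rV[R]_n) : dotv x (y - z) = dotv x y - dotv x z.
Proof. by rewrite dotvDr dotvNr. Qed.

Lemma dotv0r (n : nat) (x : 'rV[R]_n) : dotv x 0 = 0.
Proof. by rewrite -(scale0r 0) dotvZr mul0r. Qed.

Lemma dotv0l (n : nat) (x : 'rV[R]_n) : dotv 0 x = 0.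
Proof. by rewrite dotvC dotv0r. Qed.

Lemma dotv_ge0 (n : nat) (x : 'rV[R]_n) : 0 <= dotv x x.
Proof. by apply: sumr_ge0 => i _; rewrite -expr2 sqr_ge0. Qed.

Lemma dotv_eq0 (n : nat) (x : 'rV[R]_n) : (dotv x x == 0) = (x == 0).
Proof.
apply/eqP/eqP => [xx0|->]; last exact: dotv0r.
apply/rowP => i; rewrite mxE.
have /psumr_eq0P /(_ xx0 i isT)/eqP : forall i : 'I_n, true -> 0 <= x 0 i * x 0 i.
  by move=> j _; rewrite -expr2 sqr_ge0.
by rewrite mulf_eq0 orbb => /eqP.
Qed.

Lemma dotv_gt0 (n : nat) (x : 'rV[R]_n) : (0 < dotv x x) = (x != 0).
Proof. by rewrite lt_neqAle dotv_ge0 andbT eq_sym dotv_eq0. Qed.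

Lemma enormE (n : nat) (x : 'rV[R]_n) : enorm x ^+ 2 = dotv x x.
Proof. by rewrite /enorm sqr_sqrtr // dotv_ge0. Qed.

Lemma enorm_ge0 (n : nat) (x : 'rV[R]_n) : 0 <= enorm x.
Proof. exact: sqrtr_ge0. Qed.

(** This root-free inequality replaces Cauchy-Schwarz throughout; the loss is only in constants. *)
Lemma normr_dotv_le (n : nat) (x y : 'rV[R]_n) :
  `|dotv x y| <= (dotv x x + dotv y y) / 2.
Proof.
have := dotv_ge0 (x + y); have := dotv_ge0 (x - y).
rewrite !(dotvBr, dotvDr, dotvDl, dotvNl) (dotvC y x) ler_norml => *; lra.
Qed.

Definition mkpt (m : nat) (y : 'rV[R]_m) (s : R) : 'rV[R]_m.+1 :=
  \row_i (if unlift ord_max i is Some j then y 0 j else s).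

Lemma xlast_mkpt (m : nat) (y : 'rV[R]_m) (s : R) : xlast (mkpt y s) = s.
Proof. by rewrite /xlast mxE unlift_none. Qed.

Lemma xprime_mkpt (m : nat) (y : 'rV[R]_m) (s : R) : xprime (mkpt y s) = y.
Proof. by apply/rowP => i; rewrite !mxE liftK. Qed.

Lemma mkptK (m : nat) (x : 'rV[R]_m.+1) : mkpt (xprime x) (xlast x) = x.
Proof.
apply/rowP => i; rewrite mxE.
by case: unliftP => [j|] ->; rewrite ?mxE.
Qed.

Lemma mkptD (m : nat) (y z : 'rV[R]_m) (s t : R) :
  mkpt y s + mkpt z t = mkpt (y + z) (s + t).
Proof. by apply/rowP => i; rewrite !mxE; case: unliftP => [j|] _; rewrite ?mxE. Qed.

Lemma mkptZ (m : nat) (y : 'rV[R]_m) (s t : R) :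
  t *: mkpt y s = mkpt (t *: y) (t * s).
Proof. by apply/rowP => i; rewrite !mxE; case: unliftP => [j|] _; rewrite ?mxE. Qed.

Lemma e_lastE (m : nat) : e_last R m = mkpt 0 1.
Proof.
apply/rowP => i; rewrite !mxE eqxx /=; case: unliftP => [j|] ->; rewrite ?mxE ?eqxx //.
by rewrite eq_sym (negbTE (neq_lift _ _)).
Qed.

Lemma dotv_mkpt (m : nat) (y z : 'rV[R]_m) (s t : R) :
  dotv (mkpt y s) (mkpt z t) = dotv y z + s * t.
Proof.
rewrite /dotv big_ord_recr /= !mxE !unlift_none; congr (_ + _).
apply: eq_bigr => i _; rewrite !mxE.
have -> : widen_ord (leqnSn m) i = lift ord_max i.
  by apply: val_inj; rewrite /= /bump leqNgt ltn_ord.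
by rewrite liftK.
Qed.

Lemma dotv_e_last (m : nat) (x : 'rV[R]_m.+1) : dotv (e_last R m) x = xlast x.
Proof. by rewrite e_lastE -{1}(mkptK x) dotv_mkpt dotv0l add0r mul1r. Qed.

Lemma dotv_xprime (m : nat) (x : 'rV[R]_m.+1) :
  dotv x x = dotv (xprime x) (xprime x) + xlast x ^+ 2.
Proof. by rewrite -{1 2}(mkptK x) dotv_mkpt expr2. Qed.

Lemma xlastD (m : nat) (x y : 'rV[R]_m.+1) : xlast (x + y) = xlast x + xlast y.
Proof. by rewrite /xlast mxE. Qed.

Lemma xlastZ (m : nat) (t : R) (x : 'rV[R]_m.+1) : xlast (t *: x) = t * xlast x.
Proof. by rewrite /xlast mxE. Qed.

Lemma continuous_coord (n : nat) (i : 'I_n) : continuous (fun x : 'rV[R]_n => x 0 i).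
Proof. exact: coord_continuous. Qed.

Lemma continuous_addf (T : topologicalType) (f g : T -> R) :
  continuous f -> continuous g -> continuous (fun x => f x + g x).
Proof. by move=> cf cg x; exact: (@cvgD _ _ _ _ _ _ _ _ _ (cf x) (cg x)). Qed.

Lemma continuous_subf (T : topologicalType) (f g : T -> R) :
  continuous f -> continuous g -> continuous (fun x => f x - g x).
Proof. by move=> cf cg x; exact: (@cvgB _ _ _ _ _ _ _ _ _ (cf x) (cg x)). Qed.

Lemma continuous_mulf (T : topologicalType) (f g : T -> R) :
  continuous f -> continuous g -> continuous (fun x => f x * g x).
Proof. by move=> cf cg x; exact: (@cvgM _ _ _ _ _ _ _ _ (cf x) (cg x)). Qed.

Lemma continuous_cstf (T : topologicalType) (a : R) : continuous (fun _ : T => a).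
Proof. by move=> x; exact: cvg_cst. Qed.

Lemma continuous_sum_ord (T : topologicalType) (n : nat) (F : 'I_n -> T -> R) :
  (forall i, continuous (F i)) -> continuous (fun x => \sum_(i < n) F i x).
Proof.
move=> cF; elim: n F cF => [|n IH] F cF.
  rewrite (_ : (fun x => _) = (fun=> 0)); first exact: cst_continuous.
  by apply/funext => x; rewrite big_ord0.
rewrite (_ : (fun x => _) = (fun x => \sum_(i < n) F (widen_ord (leqnSn n) i) x + F ord_max x)).
  by move=> x; apply: cvgD; [exact: (IH (fun i => F (widen_ord (leqnSn n) i)))|exact: cF].
by apply/funext => x; rewrite big_ord_recr.
Qed.

Lemma continuous_dotv (n : nat) (a : 'rV[R]_n) : continuous (fun x => dotv a x).
Proof.
apply: continuous_sum_ord => i.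
by apply: continuous_mulf; [exact: continuous_cstf|exact: continuous_coord].
Qed.

Lemma continuous_dotvv (n : nat) : continuous (fun x : 'rV[R]_n => dotv x x).
Proof.
by apply: continuous_sum_ord => i; apply: continuous_mulf; exact: continuous_coord.
Qed.

Lemma continuous_xlast (m : nat) : continuous (@xlast R m).
Proof. exact: continuous_coord. Qed.

Lemma continuous_line (n : nat) (x d : 'rV[R]_n) : continuous (fun t : R => x + t *: d).
Proof.
move=> t.
apply: (@cvgD _ _ _ _ _ (fun=> x) _ _ _ (@cvg_cst _ _ _ _ _)).
by apply: (@cvgZr_tmp R 'rV[R]_n _ _ _ id t d); exact: cvg_id.
Qed.

(** Each squared coordinate is at most [dotv x x], which bounds the sup norm of the library. *)
Lemma compact_of_dotv_le (n : nat) (A : set 'rV[R]_n) (B : R) :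
  closed A -> (forall x, A x -> dotv x x <= B) -> compact A.
Proof.
move=> cA AB; apply: bounded_closed_compact => //.
exists (B + 1); split; first by rewrite num_real.
move=> C BC x /= /AB xB; have B0 : 0 <= B by apply: le_trans xB; exact: dotv_ge0.
rewrite /Num.norm /= mx_normrE.
apply/bigmax_leP; split => [|[i j] _ /=]; first by lra.
have : `|x i j| ^+ 2 <= B.
  apply: le_trans xB; rewrite (ord1 i) /dotv (bigD1 j) //= real_normK ?num_real // expr2 lerDl.
  by apply: sumr_ge0 => k _; rewrite -expr2 sqr_ge0.
by move=> H; rewrite leNgt; apply/negP => yC; nra.
Qed.

End coordinates.

(** * Convex sets and functions *)

Section convexity.
Context (R : realType) (n : nat).
Implicit Types (A Omega : set 'rV[R]_n) (x y z : 'rV[R]_n).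

Definition cvx_set A := forall x y (t : R), A x -> A y -> 0 <= t <= 1 ->
  A ((1 - t) *: x + t *: y).

Definition cvx_fun A (u : 'rV[R]_n -> R) :=
  forall x y (t : R), A x -> A y -> 0 <= t <= 1 ->
  u ((1 - t) *: x + t *: y) <= (1 - t) * u x + t * u y.

Lemma closure_sub_closed A B : closed B -> A `<=` B -> closure A `<=` B.
Proof. by move=> cB AB; rewrite [X in _ `<=` X](closure_id _).1 //; exact: closure_subset. Qed.

Lemma continuous_homothety (a b : R) x :
  continuous (fun y : 'rV[R]_n => a *: x + b *: y).
Proof.
move=> y.
have H := @scaler_continuous R 'rV[R]_n b y.
exact: (@cvgD R 'rV[R]_n _ (nbhs y) (nbhs_filter y) (fun=> a *: x) _ _ _ (@cvg_cst _ _ _ (nbhs y) (nbhs_filter y)) H).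
Qed.

(** The homothety [f] about the target point p sends x to z. For y in Omega close to x the image
    [f y] is still in Omega, and p lies on the segment from y to [f y]. *)
Lemma cvx_closure_interior Omega x z (t : R) : open Omega -> cvx_set Omega ->
  closure Omega x -> Omega z -> 0 < t -> t <= 1 -> Omega ((1 - t) *: x + t *: z).
Proof.
move=> oO cO clx Oz t0 t1; set p := (1 - t) *: x + t *: z.
pose f y := t^-1 *: p + (- (t^-1 * (1 - t))) *: y.
have fx : f x = z.
  rewrite /f /p scalerDr !scalerA mulVf ?gt_eqF // scale1r scaleNr addrAC subrr.
  exact: add0r.
have : nbhs x (f @^-1` Omega).
  by apply: continuous_homothety; rewrite -/(f x) fx; exact: open_nbhs_nbhs.
move=> /clx[y [Oy Ofy]].
have -> : p = (1 - t) *: y + t *: f y.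
  rewrite /f scalerDr !scalerA mulrN mulrA divff ?gt_eqF // !scale1r mul1r scaleNr.
  by rewrite addrCA subrr addr0.
by apply: cO => //; rewrite (ltW t0).
Qed.

Lemma cvx_set_closure Omega : cvx_set Omega -> cvx_set (closure Omega).
Proof.
move=> cO.
have closed_pre f : continuous f -> closed (f @^-1` closure Omega).
  by move=> cf; apply: preimage_closed => //; exact: closed_closure.
have H x y t : Omega x -> closure Omega y -> 0 <= t <= 1 ->
    closure Omega ((1 - t) *: x + t *: y).
  move=> Ox + t01; move: y.
  apply: (@closure_sub_closed _ ((fun y => (1 - t) *: x + t *: y) @^-1` closure Omega)).
    by apply: closed_pre; exact: continuous_homothety.
  by move=> y Oy; apply: subset_closure; exact: cO.
move=> x y t + Oy t01; move: x.
apply: (@closure_sub_closed _ ((fun x => (1 - t) *: x + t *: y) @^-1` closure Omega)).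
  apply: closed_pre.
  rewrite (_ : (fun x => _) = (fun x => t *: y + (1 - t) *: x)).
    exact: continuous_homothety.
  by apply/funext => x; rewrite addrC.
by move=> x Ox; exact: H.
Qed.

Lemma boundaryE Omega x : open Omega ->
  boundary Omega x <-> closure Omega x /\ ~ Omega x.
Proof. by move=> oO; rewrite /boundary ((interior_id Omega).1 oO). Qed.

(** The exit time is the infimum of the times spent outside. Being outside is a closed condition, so
    the exit point is outside, while points just before it are inside. *)
Lemma exit_boundary Omega x d (T : R) : open Omega -> Omega x -> 0 <= T ->
  ~ Omega (x + T *: d) ->
  exists t, [/\ 0 < t, t <= T, boundary Omega (x + t *: d) &
                forall s, 0 <= s -> s < t -> Omega (x + s *: d)].
Proof.
move=> oO Ox T0 nO.
pose A := [set t : R | 0 <= t /\ ~ Omega (x + t *: d)].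
have AT : A T by [].
have lbA : has_lbound A by exists 0 => t [].
have iA : has_inf A by split => //; exists T.
have nbhs_line t (P : set 'rV[R]_n) : nbhs (x + t *: d) P ->
    exists2 e : R, 0 < e & forall s, `|t - s| < e -> P (x + s *: d).
  by move=> /(@continuous_line R n x d t)/nbhs_ballP[e /= e0 H]; exists e.
have i0 : 0 <= inf A by apply: lb_le_inf; [exists T|move=> t []].
have nOi : ~ Omega (x + inf A *: d).
  move=> Oi; have [e e0 He] : exists2 e : R, 0 < e &
      forall s, `|inf A - s| < e -> Omega (x + s *: d).
    by apply: nbhs_line; exact: open_nbhs_nbhs.
  have [s As sA] := inf_adherent e0 iA.
  apply: As.2; apply: He; have := ge_inf lbA As => ?.
  by rewrite ltr_norml; apply/andP; split; lra.
have inO s : 0 <= s -> s < inf A -> Omega (x + s *: d).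
  move=> s0 si; apply: contrapT => nOs; have := ge_inf lbA (conj s0 nOs : A s).
  by rewrite leNgt si.
have i_gt0 : 0 < inf A.
  rewrite lt_neqAle i0 andbT; apply/negP => /eqP i_eq0.
  by apply: nOi; rewrite -i_eq0 scale0r addr0.
exists (inf A); split => //; first exact: ge_inf.
apply/(boundaryE _ oO); split => // N /nbhs_line[e e0 He].
exists (x + (Num.max 0 (inf A - e / 2)) *: d); split.
  by apply: inO; rewrite ?le_max ?lexx // gt_max i_gt0 /=; lra.
apply: He; rewrite ltr_norml; case: (leP 0 (inf A - e / 2)) => H; apply/andP; split; lra.
Qed.

End convexity.

(** The library combination puts the weight t on its first argument, hence the swap of x and y here
    and in [cvx_funP]. *)
Lemma cvx_setP (R : realType) (n : nat) (A : set 'rV[R]_n) :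
  convex_set (A : set (convex_lmodType 'rV[R]_n)) -> cvx_set A.
Proof.
move=> cA x y t Ax Ay t01.
have := cA y x (Itv01 (andP t01).1 (andP t01).2) (mem_set Ay) (mem_set Ax).
by rewrite inE /conv /= /unstable.onem /= addrC.
Qed.

Lemma cvx_funP (R : realType) (n : nat) (A : set 'rV[R]_n) (u : 'rV[R]_n -> R) :
  convex_function (A : set (convex_lmodType 'rV[R]_n)) u -> cvx_fun A u.
Proof.
move=> cA x y t Ax Ay t01.
have := cA (Itv01 (andP t01).1 (andP t01).2) y x (mem_set Ay) (mem_set Ax).
by rewrite /conv /= /conv /= /unstable.onem /= addrC [leRHS]addrC.
Qed.

(** * Lebesgue outer measure *)

Section lebesgue_outer_theory.
Context (R : realType) (m : nat).
Local Notation V := 'rV[R]_m.+1.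
Implicit Types (c : V * V) (x : 'I_m.+1 -> R).

Definition side c (i : 'I_m.+1) : R := Num.max 0 (c.2 0 i - c.1 0 i).

Definition side_indic c (i : 'I_m.+1) (y : R) : R :=
  \1_(`[c.1 0 i, c.2 0 i]) y.

(** Interpolates between the indicator of the box at x (j = 0) and its volume (j = m.+1): the
    coordinates below j have been integrated out. *)
Definition partial_volume (j : nat) c x : R :=
  \prod_(i < m.+1) (if (i < j)%N then side c i else side_indic c i (x i)).

Lemma side_ge0 c i : 0 <= side c i.
Proof. by rewrite /side le_max lexx. Qed.

Lemma side_indic_ge0 c i y : 0 <= side_indic c i y.
Proof. by rewrite /side_indic indicE ler0n. Qed.

Lemma integral_side_indic (r : R) c i : 0 <= r ->
  (\int[lebesgue_measure]_y (r * side_indic c i y)%:E = (r * side c i)%:E)%E.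
Proof.
move=> r0; under eq_integral do rewrite EFinM.
rewrite ge0_integralZl_EFin //; last 2 first.
- by move=> y _; rewrite lee_fin side_indic_ge0.
- by apply/measurable_EFinP; exact: measurable_indic.
rewrite integral_indic // setIT EFinM; congr (_ * _)%E.
apply: etrans (lebesgue_measure_itv `[c.1 0 i, c.2 0 i]) _.
rewrite /= lte_fin /side; case: ltP => h; first by rewrite max_r // subr_ge0 ltW.
by rewrite max_l // subr_le0.
Qed.

Definition upd x (j : 'I_m.+1) (y : R) : 'I_m.+1 -> R :=
  fun i => if i == j then y else x i.

Definition other_sides (j : 'I_m.+1) c x : R :=
  \prod_(i < m.+1 | i != j) (if (i < j)%N then side c i else side_indic c i (x i)).

Lemma partial_volume_upd (j : 'I_m.+1) c x y :
  partial_volume j c (upd x j y) = other_sides j c x * side_indic c j y.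
Proof.
rewrite /partial_volume (bigD1 j) //= ltnn /upd eqxx mulrC; congr (_ * _).
by apply: eq_bigr => i /negPf ->.
Qed.

Lemma partial_volumeS (j : 'I_m.+1) c x :
  partial_volume j.+1 c x = other_sides j c x * side c j.
Proof.
rewrite /partial_volume (bigD1 j) //= ltnSn mulrC; congr (_ * _).
apply: eq_bigr => i ij; rewrite ltnS leq_eqVlt.
by rewrite (_ : (i == j :> nat) = false) //; apply/negbTE.
Qed.

Lemma other_sides_ge0 (j : 'I_m.+1) c x : 0 <= other_sides j c x.
Proof.
by apply: prodr_ge0 => i _; case: ifP => _; rewrite ?side_ge0 ?side_indic_ge0.
Qed.

(* Fubini for the cover inequality: integrate one coordinate at a time. *)
Lemma partial_volume_cover (b : V * V) (c : nat -> V * V) (j : nat) x :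
  box_cover (box b) c -> (j <= m.+1)%N ->
  ((partial_volume j b x)%:E <= \sum_(k <oo) (partial_volume j (c k) x)%:E)%E.
Proof.
move=> bc; have pv0 i d z : (0 <= (partial_volume i d z)%:E)%E.
  rewrite lee_fin; apply: prodr_ge0 => l _.
  by case: ifP => _; rewrite ?side_ge0 ?side_indic_ge0.
elim: j x => [x _|j IH x jm].
  have pv1 d z : box d (\row_i z i) -> partial_volume 0 d z = 1.
    move=> dz; rewrite /partial_volume big1 // => i _.
    rewrite /side_indic indicE mem_set //= in_itv /=.
    by have := dz i; rewrite mxE.
  have [bx|bx] := pselect (box b (\row_i x i)); last first.
    have [i hi] : exists i, ~ (b.1 0 i <= x i <= b.2 0 i).
      by apply/existsNP => H; apply: bx => i; rewrite mxE; exact: H.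
    rewrite [partial_volume 0 b x](_ : _ = 0); first exact: nneseries_ge0.
    have xi : x i \notin [set` `[b.1 0 i, b.2 0 i]].
      by apply/negP => /set_mem /=; rewrite in_itv /=.
    by rewrite /partial_volume (bigD1 i) //= /side_indic indicE (negbTE xi) mul0r.
  rewrite pv1 //; have [k _ ck] := bc _ bx.
  rewrite (@nneseries_split _ _ 0 k.+1) // add0n big_nat_recr //= pv1 // addeAC.
  by rewrite leeDr // adde_ge0 ?sume_ge0 // nneseries_ge0.
pose J := Ordinal jm.
have -> : partial_volume j.+1 b x = other_sides J b x * side b J.
  exact: (partial_volumeS J).
under eq_eseriesr do rewrite (partial_volumeS J) -integral_side_indic ?other_sides_ge0 //.
rewrite -integral_side_indic ?other_sides_ge0 // -integral_nneseries //; last 2 first.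
- move=> k; apply/measurable_EFinP; apply: measurable_funM => //.
  exact: measurable_indic.
- by move=> k y _; rewrite lee_fin mulr_ge0 ?other_sides_ge0 ?side_indic_ge0.
apply: ge0_le_integral => //.
- by move=> y _; rewrite lee_fin mulr_ge0 ?other_sides_ge0 ?side_indic_ge0.
- apply/measurable_EFinP; apply: measurable_funM => //.
  exact: measurable_indic.
- apply: ge0_emeasurable_sum => [k y _ _|k _]; last first.
    apply/measurable_EFinP; apply: measurable_funM => //.
    exact: measurable_indic.
  by rewrite lee_fin mulr_ge0 ?other_sides_ge0 ?side_indic_ge0.
move=> y _; have := IH (upd x J y) (ltnW jm).
rewrite (partial_volume_upd J).
by under eq_eseriesr do rewrite (partial_volume_upd J).
Qed.

(** The nontrivial half of the normalisation; the positivity of the measure of open sets rests on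
    it. *)
Lemma box_volume_le_outer (b : V * V) :
  ((box_volume b)%:E <= lebesgue_outer (box b))%E.
Proof.
apply: le_ereal_inf_tmp => _ [c bc <-].
have full d : partial_volume m.+1 d (fun=> 0) = box_volume d.
  by apply: eq_bigr => i _; rewrite ltn_ord.
have := partial_volume_cover (fun=> 0) bc (leqnn _).
by rewrite full; under eq_eseriesr do rewrite full.
Qed.

Lemma lebesgue_outer_box_le (b : V * V) :
  (lebesgue_outer (box b) <= (box_volume b)%:E)%E.
Proof.
apply: ereal_inf_lbound.
(* Covers are indexed by all of [nat], so the single box is padded with degenerate boxes of volume
   0. *)
exists (fun k => if k == 0%N then b else (0, 0)).
  by move=> x bx; exists 0%N.
rewrite (@nneseries_split _ _ 0 1) //; last by move=> k _; exact: box_volume_ge0.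
rewrite big_nat1 eseries0 ?adde0 // => -[|k] // _ _.
by rewrite /box_volume big_ord_recl /= subrr maxxx mul0r.
Qed.

(** The gradient map of the polynomial [diag_quad]. *)
Definition diag_affine (d l : 'I_m.+1 -> R) (x : V) : V :=
  \row_i (l i + d i * x 0 i).

(** A box cover of the image pulls back under the inverse map to a box cover of [E], with every
    volume divided by the determinant. *)
Lemma lebesgue_outer_diag_image (d l : 'I_m.+1 -> R) (E : set V) :
  (forall i, 0 < d i) ->
  ((\prod_i d i)%R%:E * lebesgue_outer E <=
   lebesgue_outer (diag_affine d l @` E))%E.
Proof.
move=> d0; apply: le_ereal_inf_tmp => _ [c Ec <-].
pose g (z : V) : V := \row_i ((z 0 i - l i) / d i).
pose c' k := (g (c k).1, g (c k).2).
have D0 : 0 < \prod_i d i by apply: prodr_gt0.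
have vol k : box_volume (c k) = (\prod_i d i) * box_volume (c' k).
  rewrite /box_volume -big_split; apply: eq_bigr => i _ /=.
  rewrite !mxE -mulrBl maxr_pMr ?mulr0 ?(ltW (d0 i)) //; congr (Num.max _ _).
  by rewrite mulrCA divff ?gt_eqF // mulr1; lra.
under eq_eseriesr do rewrite vol EFinM.
rewrite nneseriesZl; last by move=> k _; exact: box_volume_ge0.
rewrite lee_pmul2l ?fin_numE // ?lte_fin //.
apply: ereal_inf_lbound; exists c' => // x Ex.
have [k _ ck] := Ec _ (ex_intro2 _ _ x Ex erefl).
exists k => // i; have := ck i; rewrite !mxE.
by rewrite ler_pdivrMr // ler_pdivlMr // => /andP[? ?]; apply/andP; split; lra.
Qed.

Lemma lebesgue_outer_open_gt0 (E : set V) (x : V) :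
  open E -> E x -> (0 < lebesgue_outer E)%E.
Proof.
move=> oE Ex; have /nbhs_ballP[e /= e0 He] : nbhs x E by exact: open_nbhs_nbhs.
pose b : V * V := (\row_i (x 0 i - e / 2), \row_i (x 0 i + e / 2)).
have bE : box b `<=` E.
  move=> y by_; apply: He; split=> // i j; rewrite (ord1 i) /ball /= ltr_norml.
  by have := by_ j; rewrite !mxE => /andP[? ?]; apply/andP; split; lra.
apply: lt_le_trans (le_lebesgue_outer bE).
apply: lt_le_trans (box_volume_le_outer b).
rewrite lte_fin; apply: prodr_gt0 => i _; rewrite lt_max !mxE; apply/orP; right; lra.
Qed.

Lemma lebesgue_outer_bounded (E : set V) (B : R) :
  (forall x : V, E x -> dotv x x <= B) -> (lebesgue_outer E < +oo)%E.
Proof.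
move=> EB.
pose b : V * V := (const_mx (- (B + 1)), const_mx (B + 1)).
have Eb : E `<=` box b.
  move=> x /EB xB i; rewrite !mxE.
  have : x 0 i * x 0 i <= B.
    apply: le_trans xB; rewrite /dotv (bigD1 i) //= lerDl.
    by apply: sumr_ge0 => k _; rewrite -expr2 sqr_ge0.
  by move=> ?; apply/andP; split; nra.
apply: le_lt_trans (le_lebesgue_outer Eb) _.
by apply: le_lt_trans (lebesgue_outer_box_le b) _; rewrite ltry.
Qed.

End lebesgue_outer_theory.

(** * Comparison with quadratic polynomials *)

Section comparison.
Import HBNNSimple.
Context (R : realType) (m : nat).
Local Notation V := 'rV[R]_m.+1.
Implicit Types (E D Kc Omega : set V) (u f : V -> R).

(* The set where a minorizing simple function is positive is measurable, so
   that measurability of E itself is not needed. *)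
Lemma integral_le_lebesgue_outer f E (Lam : R) : 0 <= Lam ->
  (forall x, E x -> 0 <= f x <= Lam) ->
  (\int[lebesgue_rV R m]_(x in E) (f x)%:E <= Lam%:E * lebesgue_outer E)%E.
Proof.
move=> Lam0 fE; rewrite ge0_integralE; last first.
  by move=> x /fE/andP[? _]; rewrite lee_fin.
apply: ge_ereal_sup => _ [h hf <-].
have h0 x : 0 <= h x by exact: fun_ge0.
have hE x : ~ E x -> h x = 0.
  move=> nEx; apply/eqP; rewrite eq_le h0 andbT -lee_fin.
  by have := hf x; rewrite /patch memNset.
have hLam x : h x <= Lam.
  have [Ex|/hE -> //] := pselect (E x).
  have := hf x; rewrite /patch mem_set // lee_fin => /le_trans; apply.
  by have /andP[] := fE _ Ex.
have mh : measurable_fun setT h by exact: measurable_funPT.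
pose A := h @^-1` (~` [set 0]).
have mA : measurable A by rewrite -[A]setTI; apply: mh => //; exact: measurableC.
have AE : A `<=` E by move=> x; apply: contra_notP => /hE.
rewrite -integralT_nnsfun.
apply: (@le_trans _ _ (\int[lebesgue_rV R m]_x (Lam%:E * (\1_A x)%:E))%E).
  apply: ge0_le_integral; first exact: measurableT.
  - by move=> x _; rewrite lee_fin.
  - exact/measurable_EFinP.
  - by apply: measurable_funeM; apply/measurable_EFinP; exact: measurable_indic.
  move=> x _; rewrite -EFinM lee_fin indicE.
  have [xA|xA] := boolP (x \in A); first by rewrite mulr1.
  rewrite mulr0; have [->//|hx0] := eqVneq (h x) 0.
  by exfalso; move/negP: xA; apply; apply/mem_set/eqP.
rewrite ge0_integralZl_EFin;
  [|exact: measurableT|by move=> x _; rewrite lee_fin| |exact: Lam0]; last first.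
  by apply/measurable_EFinP; exact: measurable_indic.
rewrite integral_indic // setIT; apply: lee_wpmul2l; first by rewrite lee_fin.
exact: le_lebesgue_outer.
Qed.

Definition diag_quad (c0 : R) (l d : 'I_m.+1 -> R) (x : V) : R :=
  c0 + \sum_i (l i * x 0 i + d i / 2 * x 0 i ^+ 2).

Lemma diag_quadB c0 l d x z :
  diag_quad c0 l d x - diag_quad c0 l d z =
  dotv (diag_affine d l z) (x - z) + \sum_i d i / 2 * (x 0 i - z 0 i) ^+ 2.
Proof.
rewrite /diag_quad opprD addrACA subrr add0r -sumrB -big_split.
by apply: eq_bigr => i _; rewrite !mxE /=; field.
Qed.

Lemma continuous_diag_quad c0 l d : continuous (diag_quad c0 l d).
Proof.
apply: continuous_addf; first exact: continuous_cstf.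
apply: continuous_sum_ord => i; have cx := @continuous_coord R m.+1 i.
apply: continuous_addf; apply: continuous_mulf => //; try exact: continuous_cstf.
exact: continuous_mulf.
Qed.

(** The form in which the equation enters comparison. Open sets are enough, since the set where a
    continuous barrier exceeds u is open. *)
Definition monge_ampere_le Omega u (Lam : R) := forall E, open E -> E `<=` Omega ->
  (monge_ampere Omega u E <= Lam%:E * lebesgue_outer E)%E.

(** Let [E] be the part of D where u < w. Every gradient of w on [E] is a subgradient of u at some
    point of [E], so det D^2 w times the measure of [E] is at most [Lam] times that measure. As [E]
    is open and bounded, its measure is positive and finite if [E] is nonempty, which contradicts
    det D^2 w > [Lam]. The compact set [Kc] provides the contact points. *)
Lemma comparison_principle Omega D Kc u (Lam c0 B : R) (l d : 'I_m.+1 -> R) :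
  open Omega -> cvx_set Omega -> cvx_fun Omega u ->
  {within closure Omega, continuous u} -> monge_ampere_le Omega u Lam ->
  open D -> D `<=` Omega -> closed Kc -> (forall x, Kc x -> dotv x x <= B) ->
  D `<=` Kc -> Kc `<=` closure Omega ->
  (forall i, 0 < d i) -> Lam < \prod_i d i ->
  (forall x, Kc x -> ~ D x -> diag_quad c0 l d x <= u x) ->
  forall x, D x -> diag_quad c0 l d x <= u x.
Proof.
move=> oO cO cu uc MA oD DO cK KB DK KO d0 Ld bw x0 Dx0; set w := diag_quad c0 l d.
rewrite leNgt; apply/negP => ux0.
pose E := [set x | D x /\ u x < w x].
have ucx x : Omega x -> {for x, continuous u}.
  move=> Ox; have : {within Omega, continuous u}.
    by apply: continuous_subspaceW uc; exact: subset_closure.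
  by rewrite continuous_open_subspace // => /(_ x); apply; exact: mem_set.
have oE : open E.
  rewrite openE => x [Dx uwx]; rewrite /interior.
  have cuw : {for x, continuous (fun y => w y - u y)}.
    exact: (@cvgB _ _ _ _ _ _ _ _ _ (@continuous_diag_quad c0 l d x) (ucx x (DO _ Dx))).
  have : \forall y \near x, 0 < w y - u y by apply: (cvgr_gt _ cuw); rewrite subr_gt0.
  have : \forall y \near x, D y by exact: open_nbhs_nbhs.
  apply: filterS2 => y Dy; rewrite subr_gt0 => uwy; exact: (conj Dy uwy).
have Ex0 : E x0 by [].
have EO : E `<=` Omega by move=> x [/DO].
have grad_sub : diag_affine d l @` E `<=` \bigcup_(x in E) subdifferential Omega u x.
  (* Lower the tangent plane of w at z until it touches u: since u >= w outside
     D, this happens at a point of E. *)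
  move=> _ [z [Dz uwz] <-]; set p := diag_affine d l z.
  pose L y := w z + dotv p (y - z).
  have Lw y : L y <= w y.
    rewrite -lerBrDl /w diag_quadB lerDl.
    by apply: sumr_ge0 => i _; rewrite mulr_ge0 ?sqr_ge0 // divr_ge0 // ltW.
  have cL : continuous L.
    apply: continuous_addf; first exact: continuous_cstf.
    rewrite (_ : (fun y => _) = (fun y => dotv p y + - dotv p z)).
      by apply: continuous_addf; [exact: continuous_dotv|exact: continuous_cstf].
    by apply/funext => y'; rewrite dotvBr.
  have [] := @compact_EVT_min V R (fun y => u y - L y) Kc.
  - by exists z; exact: DK.
  - exact: compact_of_dotv_le KB.
  - have uK := continuous_subspaceW KO uc.
    have LK := @continuous_subspaceT _ _ Kc _ cL.
    by move=> y; exact: (@cvgB _ _ _ _ _ _ _ _ _ (uK y) (LK y)).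
  move=> y /set_mem Ky ymin.
  have uLz : u z < L z by rewrite /L subrr dotv0r addr0.
  have uLy : u y < L y.
    by have := ymin _ (mem_set (DK _ Dz)); move: uLz; lra.
  have Dy : D y.
    apply: contrapT => /(bw _ Ky); rewrite leNgt => /negP; apply.
    exact: lt_le_trans uLy (Lw y).
  exists y; first by split => //; exact: lt_le_trans uLy (Lw y).
  move=> y' Oy'.
  have Oy := DO _ Dy.
  (* Minimality over [Kc] is only tested at a point close to y; convexity of u along the segment
     from y to y' turns this into the supporting inequality at y', anywhere in Omega. *)
  have [e e0 He] : exists2 e : R, 0 < e & forall s, `|0 - s| < e -> D (y + s *: (y' - y)).
    have : nbhs (y + 0 *: (y' - y)) D by rewrite scale0r addr0; exact: open_nbhs_nbhs.
    by move=> /(@continuous_line R _ y (y' - y) 0)/nbhs_ballP[e /= e0 H]; exists e.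
  pose s := Num.min 1 (e / 2).
  have s0 : 0 < s by rewrite lt_min ltr01 /= divr_gt0.
  have s1 : s <= 1 by rewrite ge_min lexx.
  have se : s <= e / 2 by rewrite ge_min lexx orbT.
  have := ymin (y + s *: (y' - y)).
  rewrite mem_set; last first.
    apply: DK; apply: He; rewrite sub0r normrN gtr0_norm //; lra.
  move=> /(_ isT).
  have -> : y + s *: (y' - y) = (1 - s) *: y + s *: y'.
    by rewrite scalerBr scalerBl scale1r addrCA addrC -addrA.
  have := cu y y' s Oy Oy'; rewrite s1 ltW // => /(_ isT).
  rewrite /L !(dotvBr, dotvDr, dotvZr); set a := dotv p y; set b := dotv p y'.
  move=> h1 h2; have : s * (u y' - u y - (b - a)) >= 0 by lra.
  by rewrite pmulr_rge0 //; lra.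
have h1 := le_lebesgue_outer grad_sub.
have h2 := lebesgue_outer_diag_image l E d0.
have h3 := le_trans (le_trans h2 h1) (MA _ oE EO).
have Efin : (lebesgue_outer E < +oo)%E.
  by apply: (@lebesgue_outer_bounded _ _ _ B) => x [/DK/KB].
have Epos := lebesgue_outer_open_gt0 oE Ex0.
move: h3; rewrite leNgt => /negP; apply.
by rewrite lte_pmul2r // ge0_fin_numE // ltW.
Qed.

End comparison.

Section comparison_cylindric.
Context (R : realType) (m : nat).
Local Notation V := 'rV[R]_m.+1.

Lemma dotv_xprimeE (x : V) :
  dotv (xprime x) (xprime x) = \sum_(i < m) x 0 (widen_ord (leqnSn m) i) ^+ 2.
Proof.
apply: eq_bigr => i _; rewrite !mxE -expr2; congr (x 0 _ ^+ 2).
by apply: val_inj; rewrite /= /bump leqNgt ltn_ord.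
Qed.

(** The Hessian has m diagonal entries 2b and one entry 2A. All the barriers used below are of this
    shape. *)
Lemma comparison_cylindric (Omega D Kc : set V) (u : V -> R) (Lam c0 B b A : R) (p : V) :
  open Omega -> cvx_set Omega -> cvx_fun Omega u ->
  {within closure Omega, continuous u} -> monge_ampere_le Omega u Lam ->
  open D -> D `<=` Omega -> closed Kc -> (forall x, Kc x -> dotv x x <= B) ->
  D `<=` Kc -> Kc `<=` closure Omega ->
  0 < b -> 0 < A -> Lam < (2 * b) ^+ m * (2 * A) ->
  let w x := c0 + dotv p x + b * dotv (xprime x) (xprime x) + A * xlast x ^+ 2 in
  (forall x, Kc x -> ~ D x -> w x <= u x) -> forall x, D x -> w x <= u x.
Proof.
move=> oO cO cu uc MA oD DO cK KB DK KO b0 A0 LbA w bw.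
pose d (i : 'I_m.+1) := if i == ord_max then 2 * A else 2 * b.
have wE x : w x = diag_quad c0 (fun i => p 0 i) d x.
  rewrite /w /diag_quad /dotv big_split addrA -!addrA; do 2!congr (_ + _).
  rewrite big_ord_recr /= /d eqxx; congr (_ + _); last by rewrite /xlast; field.
  rewrite -/(dotv _ _) dotv_xprimeE mulr_sumr; apply: eq_bigr => i _.
  have -> : (widen_ord (leqnSn m) i == ord_max) = false.
    by apply/negbTE; rewrite -val_eqE /= ltn_eqF.
  by field.
move=> x Dx; rewrite wE.
apply: (@comparison_principle _ _ Omega D Kc u Lam c0 B) => //.
- by move=> i; rewrite /d; case: ifP => _; rewrite mulr_gt0.
- rewrite big_ord_recr /= {2}/d eqxx (eq_bigr (fun=> 2 * b)) => [|i _].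
    by rewrite prodr_const card_ord.
  rewrite /d (_ : _ == _ = false) //.
  by apply/negbTE; rewrite -val_eqE /= ltn_eqF.
- by move=> y Ky nDy; rewrite -wE; exact: bw.
Qed.

End comparison_cylindric.

(** * Polynomials of degree two *)

Section quadratic_polynomials.
Context (R : realType) (n : nat).
Local Notation var i := (mpolyX R (mnm1 i) : mpoly n R).

Definition taylor2 (p : mpoly n R) := forall y : 'rV[R]_n,
  peval p y = peval p 0 + dotv (pgrad p 0) y + dotv y (y *m phess p 0) / 2.

Lemma taylor2_linear (c : R) (p q : mpoly n R) :
  taylor2 p -> taylor2 q -> taylor2 (c *: p + q).
Proof.
move=> tp tq y.
have pe z (p1 p2 : mpoly n R) : peval (c *: p1 + p2) z = c * peval p1 z + peval p2 z.
  by rewrite /peval mevalD mevalZ.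
have md i (p1 p2 : mpoly n R) : mderiv i (c *: p1 + p2) = c *: mderiv i p1 + mderiv i p2.
  by rewrite mderivD mderivZ.
have -> : pgrad (c *: p + q) 0 = c *: pgrad p 0 + pgrad q 0.
  by apply/rowP => i; rewrite !mxE md pe.
have -> : phess (c *: p + q) 0 = c *: phess p 0 + phess q 0.
  by apply/matrixP => i j; rewrite !mxE !md pe.
rewrite !pe tp tq dotvDl dotvZl mulmxDr -scalemxAr dotvDr dotvZr; ring.
Qed.

Lemma mderiv_var (i k : 'I_n) : mderiv k (var i) = mpolyC n ((k == i)%:R : R).
Proof.
rewrite mderivX mnm1E eq_sym; have [->|_] := eqVneq k i.
  rewrite scale1r (_ : mnm_sub (mnm1 i) (mnm1 i) = mnm0) ?mpolyX0 //.
  by apply/mnmP => j; rewrite mnmBE subnn mnm0E.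
by rewrite scale0r mpolyC0.
Qed.

Lemma taylor2_1 : taylor2 1.
Proof.
move=> y.
have -> : pgrad (1 : mpoly n R) 0 = 0.
  by apply/rowP => i; rewrite !mxE -mpolyC1 mderivC /peval meval0.
have -> : phess (1 : mpoly n R) 0 = 0.
  by apply/matrixP => i j; rewrite !mxE -mpolyC1 !(mderivC, mderiv0) /peval meval0.
by rewrite mulmx0 dotv0r dotv0l mul0r !addr0 /peval !meval1.
Qed.

Lemma sum_deltal (i : 'I_n) (F : 'I_n -> R) : \sum_k (k == i)%:R * F k = F i.
Proof.
rewrite (bigD1 i) //= eqxx mul1r big1 ?addr0 // => k /negPf ->.
by rewrite mul0r.
Qed.

Lemma taylor2_var i : taylor2 (var i).
Proof.
move=> y.
have -> : phess (var i) 0 = 0.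
  by apply/matrixP => k l; rewrite !mxE mderiv_var mderivC /peval meval0.
rewrite mulmx0 dotv0r mul0r addr0 /peval !mevalXU mxE add0r.
rewrite -[LHS](sum_deltal i (fun k => y 0 k)); apply: eq_bigr => k _.
by rewrite mxE mderiv_var /peval mevalC.
Qed.

Lemma taylor2_var2 i j : taylor2 (var i * var j).
Proof.
move=> y.
have md k : mderiv k (var i * var j) =
    mpolyC n ((k == i)%:R : R) * var j + var i * mpolyC n ((k == j)%:R : R).
  by rewrite mderivM !mderiv_var.
have -> : pgrad (var i * var j) 0 = 0.
  apply/rowP => k; rewrite !mxE md /peval mevalD !mevalM !mevalC !mevalXU !mxE.
  by rewrite mulr0 mul0r addr0.
have hE : phess (var i * var j) 0 =
    \matrix_(k, l) ((l == i)%:R * (k == j)%:R + (k == i)%:R * (l == j)%:R).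
  apply/matrixP => k l; rewrite !mxE md mderivD !mderivM !mderivC !mderiv_var.
  by rewrite /peval mul0r mulr0 add0r addr0 mevalD !mevalM !mevalC.
rewrite dotv0l /peval !mevalM !mevalXU !mxE mul0r !add0r.
have -> : dotv y (y *m phess (var i * var j) 0) = 2 * (y 0 i * y 0 j).
  rewrite hE /dotv.
  under eq_bigr => k _.
    rewrite mxE.
    under eq_bigr => l _ do rewrite mxE mulrDr.
    rewrite big_split /=.
    under [X in X + _]eq_bigr => l _.
      rewrite (_ : _ * _ = (l == j)%:R * (y 0 l * (k == i)%:R)); last by ring.
      over.
    under [X in _ + X]eq_bigr => l _.
      rewrite (_ : _ * _ = (l == i)%:R * (y 0 l * (k == j)%:R)); last by ring.
      over.
    rewrite !sum_deltal.
    rewrite (_ : _ * _ = (k == i)%:R * (y 0 k * y 0 j) + (k == j)%:R * (y 0 k * y 0 i)); last by ring.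
    over.
  by rewrite big_split /= !sum_deltal; ring.
by field.
Qed.

(** The expansion is linear in p, and a monomial of degree at most 2 is 1, a variable, or a product
    of two variables. *)
Lemma quadratic_taylor2 (p : mpoly n R) : quadratic p -> taylor2 p.
Proof.
rewrite /quadratic => p3; rewrite [p]mpolyE.
have : forall mm, mm \in msupp p -> taylor2 (mpolyX R mm).
  move=> mm /msize_mdeg_lt /leq_trans /(_ p3); rewrite ltnS.
  have [->|[i mi]] : mm = @mnm0 n \/ exists i, mm i != 0%N.
    have [->|/eqP mm0] := eqVneq mm (@mnm0 n); [by left|right].
    apply: contrapT => H; apply: mm0; apply/mnmP => i; rewrite mnm0E.
    by apply/eqP/negP => /negP h; apply: H; exists i.
  - by move=> _; rewrite mpolyX0; exact: taylor2_1.
  have -> : mm = mnm_add (mnm1 i) (mnm_sub mm (mnm1 i)).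
    by rewrite addmC submK // lep1mP.
  set m1 := (mnm_sub mm (mnm1 i)); rewrite mdegD mdeg1 add1n ltnS leq_eqVlt ltnS leqn0.
  case/orP => [/mdeg1P[j /eqP ->]|].
    by rewrite mpolyXD; exact: taylor2_var2.
  rewrite mdeg_eq0 => /eqP ->; rewrite addm0; exact: taylor2_var.
elim: (msupp p) => [_|mm s IH H].
  rewrite big_nil -[X in taylor2 X](addr0 0) -[X in X + 0](scale0r 1).
  by apply: taylor2_linear; [exact: taylor2_1|];
    rewrite -[X in taylor2 X](subrr 1) addrC -scaleN1r; apply: taylor2_linear; exact: taylor2_1.
rewrite big_cons; apply: taylor2_linear; first by apply: H; rewrite mem_head.
by apply: IH => k ks; apply: H; rewrite inE ks orbT.
Qed.

(** [opnorm] is a real [sup], so it dominates its set only after some upper bound has been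
    exhibited. *)
Lemma enorm_mul_le_opnorm (A : 'M[R]_n) (v : 'rV[R]_n) :
  enorm v <= 1 -> enorm (v *m A) <= opnorm A.
Proof.
move=> v1; apply: sup_upper_bound; last by exists v.
split; first by exists (enorm (v *m A)), v.
(* Each coordinate of [w *m A] is the product of w with a column of A, at most 1 plus the squared
   norm of that column. *)
exists (Num.sqrt (\sum_j (1 + dotv (row j A^T) (row j A^T)) ^+ 2)) => _ [w /= w1 <-].
rewrite ler_sqrt; last by apply: sumr_ge0 => j _; exact: sqr_ge0.
apply: ler_sum => j _; rewrite -expr2.
have -> : (w *m A) 0 j = dotv w (row j A^T).
  by rewrite mxE; apply: eq_bigr => k _; rewrite !mxE.
have := normr_dotv_le w (row j A^T); have := dotv_ge0 (row j A^T).
set a := dotv w _; set b := dotv (row j _) _ => b0 ab.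
have ww : dotv w w <= 1.
  by rewrite -enormE -(expr1n _ 2) lerXn2r // ?nnegrE ?enorm_ge0.
have {}ab : `|a| <= 1 + b by lra.
by rewrite -(real_normK (num_real a)) lerXn2r ?nnegrE // addr_ge0.
Qed.

Lemma normr_dotv_mul_le (A : 'M[R]_n) (y : 'rV[R]_n) :
  `|dotv y (y *m A)| <= (1 + opnorm A ^+ 2) / 2 * dotv y y.
Proof.
have [->|y0] := eqVneq y 0; first by rewrite !dotv0l normr0 mulr0.
have e0 : 0 < enorm y by rewrite sqrtr_gt0 dotv_gt0.
pose v := (enorm y)^-1 *: y.
have yv : y = enorm y *: v by rewrite scalerA divff ?gt_eqF // scale1r.
have vv : dotv v v = 1.
  by rewrite dotvZl dotvZr -enormE; field; rewrite gt_eqF.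
have v1 : enorm v <= 1 by rewrite /enorm vv sqrtr1.
have -> : dotv y (y *m A) = enorm y ^+ 2 * dotv v (v *m A).
  by clearbody v; rewrite {1 2}yv -scalemxAl dotvZl dotvZr mulrA expr2.
rewrite -enormE normrM mulrC.
rewrite (ger0_norm (sqr_ge0 (enorm y))) ler_wpM2r ?sqr_ge0 //.
apply: le_trans (normr_dotv_le _ _) _.
rewrite ler_pM2r // vv lerD2l -enormE lerXn2r ?nnegrE ?enorm_ge0 //.
  by apply: le_trans (enorm_mul_le_opnorm _ v1); exact: enorm_ge0.
exact: enorm_mul_le_opnorm.
Qed.

Lemma opnorm_ge0 (A : 'M[R]_n) : 0 <= opnorm A.
Proof.
apply: le_trans (enorm_mul_le_opnorm A (v := 0) _); first exact: enorm_ge0.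
by rewrite /enorm dotv0l sqrtr0.
Qed.

Lemma normr_half_dotv_mul_le (A : 'M[R]_n) (y : 'rV[R]_n) (M : R) : opnorm A <= M ->
  `|dotv y (y *m A) / 2| <= (1 + M ^+ 2) * dotv y y.
Proof.
move=> AM; have A0 := opnorm_ge0 A; have y0 := dotv_ge0 y.
have AM2 : opnorm A ^+ 2 <= M ^+ 2 by rewrite lerXn2r // nnegrE (le_trans A0).
rewrite normrM [`|2^-1|]ger0_norm ?invr_ge0 //.
have h1 := normr_dotv_mul_le A y.
have h2 : (1 + opnorm A ^+ 2) * dotv y y <= (1 + M ^+ 2) * dotv y y.
  by rewrite ler_wpM2r // lerD2l.
have h3 : 0 <= (1 + M ^+ 2) * dotv y y by rewrite mulr_ge0 // addr_ge0 ?sqr_ge0.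
lra.
Qed.

End quadratic_polynomials.

(** * The domain near the origin *)

Section domain_geometry.
Context (R : realType) (m : nat) (Omega : set 'rV[R]_m.+1) (kappa : R).
Hypotheses (m_gt0 : (0 < m)%N) (oO : open Omega) (cO : cvx_set Omega)
  (posO : forall x, Omega x -> 0 < xlast x) (bd0 : boundary Omega 0)
  (kappa_gt0 : 0 < kappa)
  (kO : forall x, boundary Omega x -> kappa * dotv x x <= xlast x).

Lemma dotv_line (n : nat) (y e : 'rV[R]_n) (t : R) :
  dotv (y + t *: e) (y + t *: e) = dotv y y + 2 * t * dotv y e + t ^+ 2 * dotv e e.
Proof. rewrite !(dotvDl, dotvDr, dotvZl, dotvZr) (dotvC e y); ring. Qed.

Lemma exit_down (y : 'rV[R]_m) (s : R) : Omega (mkpt y s) ->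
  exists2 r, 0 <= r < s & boundary Omega (mkpt y r).
Proof.
move=> Oys; have s0 : 0 < s by rewrite -(xlast_mkpt y s); exact: posO.
have [|t [t0 ts bt _]] := exit_boundary (d := mkpt 0 (-1)) oO Oys (ltW s0).
  by move=> /posO; rewrite mkptZ mkptD xlast_mkpt mulrN1 subrr ltxx.
exists (s - t); first by apply/andP; split; lra.
by move: bt; rewrite mkptZ mkptD mulrN1 scaler0 addr0.
Qed.

(** If the ray stayed inside up to time [T], the boundary point below its end would have height less
    than s but |x'|^2 > s / kappa, against uniform convexity. *)
Lemma exit_horizontal (y e : 'rV[R]_m) (s : R) : Omega (mkpt y s) -> e != 0 ->
  exists2 t, 0 < t & boundary Omega (mkpt (y + t *: e) s).
Proof.
move=> Oys e0; set N := dotv e e; have N0 : 0 < N by rewrite dotv_gt0.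
have s0 : 0 < s by rewrite -(xlast_mkpt y s); exact: posO.
set be := dotv y e; set X := s / kappa.
have X0 : 0 < X by rewrite divr_gt0.
(* Chosen so that T N absorbs the cross term 2 y.e and leaves more than X = s / kappa. *)
pose T := 1 + (2 * `|be| + X) / N.
have Tge : 0 <= (2 * `|be| + X) / N.
  by apply: divr_ge0; [apply: addr_ge0; [exact: mulr_ge0|exact: ltW]|exact: ltW].
have T0 : 0 <= T by rewrite /T; lra.
have T1 : 1 <= T by rewrite /T; lra.
have TN : T * N = N + 2 * `|be| + X by rewrite /T; field; rewrite gt_eqF.
have big : X < dotv (y + T *: e) (y + T *: e).
  rewrite dotv_line -/N -/be expr2 -(mulrA T T N) TN.
  have := dotv_ge0 y; have : - `|be| <= be by rewrite lerNl -normrN ler_norm.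
  have := normr_ge0 be; nra.
have [|t [t0 _ bt _]] := exit_boundary (d := mkpt e 0) oO Oys T0; last first.
  rewrite mkptZ mkptD mulr0 addr0 in bt.
  exists t; [exact: t0|exact: bt].
rewrite mkptZ mkptD mulr0 addr0 => /exit_down[r /andP[r0 rs]] /kO.
rewrite dotv_mkpt xlast_mkpt => H.
have : kappa * X = s by rewrite /X; field; rewrite gt_eqF.
have : kappa * X < kappa * dotv (y + T *: e) (y + T *: e) by rewrite ltr_pM2l.
by have := mulr_ge0 (ltW kappa_gt0) (mulr_ge0 r0 r0); nra.
Qed.

Lemma ones_neq0 : (const_mx 1 : 'rV[R]_m) != 0.
Proof.
apply/eqP => /rowP /(_ (Ordinal m_gt0)); rewrite !mxE => /eqP.
by rewrite oner_eq0.
Qed.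

Lemma horizontal_chord (y : 'rV[R]_m) (s : R) : Omega (mkpt y s) ->
  exists z1 z2 t, [/\ boundary Omega (mkpt z1 s), boundary Omega (mkpt z2 s),
    0 <= t <= 1 & mkpt y s = (1 - t) *: mkpt z1 s + t *: mkpt z2 s].
Proof.
move=> Oys; have [t1 t10 b1] := exit_horizontal Oys ones_neq0.
have [|t2 t20 b2] := exit_horizontal (e := - const_mx 1) Oys.
  by rewrite oppr_eq0 ones_neq0.
have t12 : 0 < t1 + t2 by rewrite addr_gt0.
exists (y + t1 *: const_mx 1), (y + t2 *: - const_mx 1), (t1 / (t1 + t2)).
split; [exact: b1|exact: b2| |].
  apply/andP; split; first by apply: divr_ge0; exact: ltW.
  by rewrite ler_pdivrMr // mul1r lerDl ltW.
rewrite !mkptZ mkptD -mulrDl subrK mul1r; congr mkpt.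
apply/rowP => i; rewrite !mxE; field; rewrite gt_eqF //.
Qed.

(** At fixed height the left side is convex and the right side constant, so the inequality passes
    from the ends of a horizontal chord to its points, then to the closure. In particular Omega is
    bounded. *)
Lemma xlast_ge_dotv x : closure Omega x -> kappa * dotv x x <= xlast x.
Proof.
move: x; apply: (@closure_sub_closed _ _ _ [set x | kappa * dotv x x <= xlast x]).
  rewrite (_ : mkset _ = (fun x => xlast x - kappa * dotv x x) @^-1` [set r | 0 <= r]).
    apply: preimage_closed; last exact: closed_ge.
    have cf : continuous (fun x : 'rV[R]_m.+1 => xlast x - kappa * dotv x x).
      apply: continuous_subf; first exact: continuous_xlast.
      by apply: continuous_mulf; [exact: continuous_cstf|exact: continuous_dotvv].
    by move=> x _; exact: cf.
  by apply/seteqP; split => x /=; rewrite subr_ge0.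
move=> x; rewrite -(mkptK x) => /horizontal_chord[z1 [z2 [t [b1 b2 /andP[t0 t1]]]]] /= ->.
have := kO b1; have := kO b2.
rewrite !mkptZ mkptD -mulrDl subrK mul1r !dotv_mkpt !xlast_mkpt.
have := dotv_ge0 (z1 - z2).
rewrite !(dotvDl, dotvDr, dotvZl, dotvZr, dotvNl, dotvNr) (dotvC z2 z1).
set a := dotv z1 z1; set b := dotv z2 z2; set c := dotv z1 z2; set s := xlast x.
move=> abc Hb Ha.
have t10 : 0 <= t * (1 - t) by rewrite mulr_ge0 // subr_ge0.
have h1 : 0 <= kappa * (t * (1 - t)) * (a - 2 * c + b).
  by rewrite !mulr_ge0 ?(ltW kappa_gt0) //; lra.
have h2 : 0 <= t * (s - kappa * (b + s * s)) by rewrite mulr_ge0 // subr_ge0.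
have h3 : 0 <= (1 - t) * (s - kappa * (a + s * s)) by rewrite mulr_ge0 // subr_ge0.
nra.
Qed.

Lemma xlast_closure_ge0 x : closure Omega x -> 0 <= xlast x.
Proof.
by move=> /xlast_ge_dotv; apply: le_trans; rewrite mulr_ge0 ?dotv_ge0 // ltW.
Qed.

Lemma dotv_xprime_le x : closure Omega x -> dotv (xprime x) (xprime x) <= xlast x / kappa.
Proof.
move=> /xlast_ge_dotv; rewrite dotv_xprime ler_pdivlMr // => H.
by have := mulr_ge0 (ltW kappa_gt0) (sqr_ge0 (xlast x)); lra.
Qed.

Lemma xlast_le x : closure Omega x -> xlast x <= kappa^-1.
Proof.
move=> /xlast_ge_dotv; rewrite dotv_xprime => H.
have := dotv_ge0 (xprime x) => d0.
rewrite leNgt; apply/negP => xk.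
have k1 : kappa * kappa^-1 = 1 by rewrite divff // gt_eqF.
have ki : 0 < kappa^-1 by rewrite invr_gt0.
have : 1 < kappa * xlast x by rewrite -k1 ltr_pM2l.
rewrite -subr_gt0 => h; have x0 := lt_trans ki xk.
have := mulr_gt0 h x0; have := mulr_ge0 (ltW kappa_gt0) d0; lra.
Qed.

Lemma dotv_closure_le x : closure Omega x -> dotv x x <= kappa^-1 / kappa.
Proof.
move=> cx; rewrite ler_pdivlMr // mulrC.
exact: le_trans (xlast_ge_dotv cx) (xlast_le cx).
Qed.

Lemma cvx_fun_le_boundary (u : 'rV[R]_m.+1 -> R) (K : R) :
  cvx_fun (closure Omega) u -> (forall x, boundary Omega x -> u x <= K) ->
  forall x, closure Omega x -> u x <= K.
Proof.
move=> cu uK x cx; have [Ox|nOx] := pselect (Omega x); last first.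
  by apply: uK; apply/boundaryE.
move: Ox; rewrite -(mkptK x) => /horizontal_chord[z1 [z2 [t [b1 b2 /andP[t0 t1]]]]] ->.
apply: le_trans (cu _ _ t b1.1 b2.1 _) _; first by rewrite t0.
have := uK _ b1; have := uK _ b2; nra.
Qed.

Context (M tau : R) (bq : 'rV[R]_m).
Hypotheses (M_gt0 : 0 < M) (tau_gt0 : 0 < tau)
  (Hq : forall x, boundary Omega x -> xlast x < tau ->
     `|xlast x - dotv bq (xprime x)| <= M * dotv (xprime x) (xprime x)).

Lemma nbhs_line (x d : 'rV[R]_m.+1) (P : set 'rV[R]_m.+1) : nbhs x P ->
  exists2 e : R, 0 < e & forall s, `|s| < e -> P (x + s *: d).
Proof.
move=> xP; have : nbhs (x + 0 *: d) P by rewrite scale0r addr0.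
move=> /(@continuous_line R _ x d 0)/nbhs_ballP[e /= e0 H]; exists e => // s se.
by apply: H; rewrite /ball /= sub0r normrN.
Qed.

(* Otherwise the cone with vertex 0 over a small ball of Omega would meet the
   boundary along two graphs, at linearly growing distance from each other. *)
Lemma axis_sub (s : R) : 0 < s -> s < tau -> Omega (mkpt 0 s).
Proof.
move=> s0 st; apply: contrapT => nOs.
(* A boundary point on the axis would satisfy s <= 0 by the pinching with x' = 0. *)
have ncl : ~ closure Omega (mkpt 0 s).
  move=> cls; have := Hq ((boundaryE _ oO).2 (conj cls nOs)).
  rewrite xlast_mkpt xprime_mkpt !dotv0r mulr0 subr0 => /(_ st).
  by rewrite normr_le0 gt_eqF.
have [z [Oz _]] := bd0.1 setT filterT.
have zn0 := posO Oz; set zn := xlast z in zn0; set z' := xprime z.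
have zE : z = mkpt z' zn by rewrite mkptK.
have [r0 r00 Hr] := nbhs_line (mkpt 0 1) (open_nbhs_nbhs (conj oO Oz)).
have [r r_gt0 Or] : exists2 r, 0 < r & Omega (mkpt z' (zn + r)).
  exists (r0 / 2); first by rewrite divr_gt0.
  have := Hr (r0 / 2); rewrite zE mkptZ mkptD scaler0 addr0 mulr1; apply.
  by rewrite gtr0_norm ?divr_gt0 //; lra.
have [t0 t00 Ht0] : exists2 e : R, 0 < e &
    forall t, `|t| < e -> (~` closure Omega) (mkpt 0 s + t *: mkpt z' 0).
  apply: nbhs_line; apply: open_nbhs_nbhs; split => //.
  exact: closed_openC (@closed_closure _ _).
set N := dotv z' z'; have N0 : 0 <= N := dotv_ge0 _.
(* The four bounds keep the shrunken points in Omega, keep the vertical line above them ending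
   outside the closure, keep them below height s, and make the gap t r exceed the width 2 M t^2 N
   allowed by the pinching. *)
pose t := Num.min (Num.min 1 (t0 / 2)) (Num.min (s / (2 * (zn + r))) (r / (4 * M * (N + 1)))).
have znr : 0 < zn + r by rewrite addr_gt0.
have MN : 0 < 4 * M * (N + 1) by rewrite mulr_gt0 ?mulr_gt0 //; lra.
have t_gt0 : 0 < t.
  by rewrite /t !lt_min ltr01 !divr_gt0 // mulr_gt0.
have t1 : t <= 1 by rewrite /t !ge_min lexx.
have tt0 : t <= t0 / 2 by rewrite /t !ge_min lexx !orbT.
have ts : t <= s / (2 * (zn + r)) by rewrite /t !ge_min lexx !orbT.
have tr : t <= r / (4 * M * (N + 1)) by rewrite /t !ge_min lexx !orbT.
have {}ts : t * (zn + r) < s.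
  move: ts; rewrite ler_pdivlMr ?mulr_gt0 // => ts; nra.
have {}tr : t * (4 * M * (N + 1)) <= r by rewrite -ler_pdivlMr.
have OtS (h : R) : Omega (mkpt z' h) -> Omega (mkpt (t *: z') (t * h)).
  move=> Oh; have := cvx_closure_interior oO cO bd0.1 Oh t_gt0 t1.
  by rewrite scaler0 add0r mkptZ.
have Otz : Omega (mkpt (t *: z') (t * zn)) by apply: OtS; rewrite -zE.
have Otr := OtS _ Or.
have T0 : 0 <= s - t * zn by nra.
have [|w [w0 wT bw _]] := exit_boundary (d := mkpt 0 1) oO Otz T0.
  rewrite mkptZ mkptD scaler0 addr0 mulr1 addrC subrK => Oc.
  apply: (Ht0 t); first by rewrite gtr0_norm //; lra.
  by rewrite mkptZ mkptD mulr0 addr0 add0r; exact: subset_closure.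
move: bw; rewrite mkptZ mkptD scaler0 addr0 mulr1 => bw.
have [h /andP[h0 hz] bh] := exit_down Otz.
have wr : t * r <= w.
  rewrite leNgt; apply/negP => wr; apply: (((boundaryE _ oO).1 bw).2).
  have trp : 0 < t * r by rewrite mulr_gt0.
  have -> : mkpt (t *: z') (t * zn + w) =
      (1 - w / (t * r)) *: mkpt (t *: z') (t * zn) +
      (w / (t * r)) *: mkpt (t *: z') (t * (zn + r)).
    rewrite !mkptZ mkptD -scalerDl subrK scale1r; congr mkpt.
    field; apply/andP; split; rewrite gt_eqF //.
  apply: cO => //; apply/andP; split; first by apply: divr_ge0; exact: ltW.
  by rewrite ler_pdivrMr // mul1r ltW.
have h_lt : h < tau by nra.
have w_lt : t * zn + w < tau by lra.
have := Hq bh; rewrite xlast_mkpt xprime_mkpt !(dotvZl, dotvZr) -/N => /(_ h_lt).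
have := Hq bw; rewrite xlast_mkpt xprime_mkpt !(dotvZl, dotvZr) -/N => /(_ w_lt).
set c := dotv bq z'; rewrite !ler_norml => /andP[H2a H2b] /andP[H1a H1b].
have : t * r <= 2 * M * (t * (t * N)) by lra.
rewrite [leRHS](_ : _ = t * (2 * M * (t * N))); last by ring.
rewrite ler_pM2l // => H.
have : 0 < M * t by rewrite mulr_gt0.
have : 0 <= M * t * N by rewrite mulr_ge0 // mulr_ge0 // ltW.
lra.
Qed.

Lemma axis_exit (e : 'rV[R]_m) (s : R) : 0 < s -> s < tau -> e != 0 ->
  exists t, [/\ 0 < t, boundary Omega (mkpt (t *: e) s) &
    t ^+ 2 * dotv e e <= s / kappa].
Proof.
move=> s0 st e0; have [t t0 bt] := exit_horizontal (axis_sub s0 st) e0.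
rewrite add0r in bt; exists t; split => //.
have := dotv_xprime_le bt.1; rewrite xprime_mkpt xlast_mkpt !(dotvZl, dotvZr).
by rewrite mulrA expr2.
Qed.

(** Low slices are thin, so there are boundary points over t e with t as small as wanted. They serve
    to test first-order terms against quadratic errors. *)
Lemma axis_exit_small (e : 'rV[R]_m) (L : R) : 0 < L -> e != 0 ->
  exists s t, [/\ 0 < s < tau, 0 < t, L * t < 1 & boundary Omega (mkpt (t *: e) s)].
Proof.
move=> L0 e0; set N := dotv e e; have N0 : 0 < N by rewrite dotv_gt0.
pose s := Num.min (tau / 2) (kappa * N / (4 * L ^+ 2)).
have s0 : 0 < s by rewrite lt_min !divr_gt0 // ?mulr_gt0 ?exprn_gt0.
have st : s < tau.
  apply: (@le_lt_trans _ _ (tau / 2)); first by rewrite ge_min lexx.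
  by rewrite ltr_pdivrMr // ltr_pMr // ltr1n.
have sN : s <= kappa * N / (4 * L ^+ 2) by rewrite ge_min lexx orbT.
have [t [t0 bt tN]] := axis_exit s0 st e0.
exists s, t; split=> //; first by rewrite s0.
have h4 : t ^+ 2 * N <= N / (4 * L ^+ 2).
  apply: le_trans tN _; rewrite ler_pdivrMr //; apply: le_trans sN _.
  by rewrite -mulrA mulrC.
rewrite ltNge; apply/negP => h2.
have h3 : 1 <= L ^+ 2 * t ^+ 2 by rewrite -exprMn exprn_ege1.
move: h4; rewrite ler_pdivlMr ?mulr_gt0 ?exprn_gt0 //; nra.
Qed.

(** Over -t bq the boundary height would be -t |bq|^2 + O(t^2), which is negative for small t. *)
Lemma boundary_tangent : bq = 0.
Proof.
apply/eqP/negPn/negP => bq0; set N := dotv bq bq.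
have N0 : 0 < N by rewrite dotv_gt0.
have [|s [t [/andP[s0 st] t0 Mt bt]]] := axis_exit_small (e := - bq) M_gt0.
  by rewrite oppr_eq0.
have := Hq bt; rewrite xlast_mkpt xprime_mkpt => /(_ st).
rewrite ler_norml => /andP[_].
rewrite !(dotvZl, dotvZr, dotvNl, dotvNr) -/N => H.
have h : 0 < 1 - M * t by rewrite subr_gt0.
by have := mulr_gt0 (mulr_gt0 t0 N0) h; lra.
Qed.

Lemma boundary_xlast_le x : boundary Omega x -> xlast x < tau ->
  xlast x <= M * dotv (xprime x) (xprime x).
Proof.
move=> bx xt; have := Hq bx xt; rewrite boundary_tangent dotv0l subr0.
exact: le_trans (ler_norm _).
Qed.

End domain_geometry.

(** * The boundary gradient *)

(** With the tangential part fixed, the admissible normal slopes are bounded above by any point of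
    positive height, and their supremum is again admissible. *)
Lemma boundary_gradient_exists (R : realType) (m : nat) (Omega : set 'rV[R]_m.+1)
    (u : 'rV[R]_m.+1 -> R) (b : 'rV[R]_m) (t0 : R) (z : 'rV[R]_m.+1) :
  (forall x, closure Omega x -> 0 <= xlast x) -> closure Omega z -> 0 < xlast z ->
  supporting Omega u 0 (mkpt b t0) ->
  exists g, boundary_gradient Omega u 0 (e_last R m) g.
Proof.
move=> cl0 cz z0 St0.
pose S := [set t : R | supporting Omega u 0 (mkpt b t)].
have dE t x : dotv (mkpt b t) (x - 0) = dotv b (xprime x) + t * xlast x.
  by rewrite subr0 -{1}(mkptK x) dotv_mkpt.
have ubS x : closure Omega x -> 0 < xlast x ->
    ubound S ((u x - u 0 - dotv b (xprime x)) / xlast x).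
  by move=> cx x0 t /(_ _ cx); rewrite dE ler_pdivlMr // => ?; lra.
have hS : has_sup S by split; [exists t0|exists ((u z - u 0 - dotv b (xprime z)) / xlast z); exact: ubS].
exists (mkpt b (sup S)); split.
  move=> x cx; have := cl0 _ cx; rewrite le_eqVlt => /orP[/eqP x0|x0].
    by have := St0 _ cx; rewrite !dE -x0 !mulr0.
  have := sup_le_ub (ex_intro S t0 St0) (ubS _ cx x0).
  by rewrite dE ler_pdivlMr // => ?; lra.
move=> eps eps0; rewrite e_lastE mkptZ mkptD scaler0 addr0 mulr1 => H.
have : S (sup S + eps) by [].
by move/(sup_upper_bound hS); rewrite leNgt ltrDl eps0.
Qed.

Section gradient.
Context (R : realType) (m : nat) (Omega : set 'rV[R]_m.+1) (kappa : R).
Hypotheses (m_gt0 : (0 < m)%N) (oO : open Omega) (cO : cvx_set Omega)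
  (posO : forall x, Omega x -> 0 < xlast x) (bd0 : boundary Omega 0)
  (kappa_gt0 : 0 < kappa)
  (kO : forall x, boundary Omega x -> kappa * dotv x x <= xlast x).
Context (M tau : R) (bq : 'rV[R]_m).
Hypotheses (M_gt0 : 0 < M) (tau_gt0 : 0 < tau)
  (Hq : forall x, boundary Omega x -> xlast x < tau ->
     `|xlast x - dotv bq (xprime x)| <= M * dotv (xprime x) (xprime x)).
Context (Lam K : R) (u : 'rV[R]_m.+1 -> R) (bp : 'rV[R]_m).
Hypotheses (Lam_ge0 : 0 <= Lam) (cu : cvx_fun (closure Omega) u)
  (uc : {within closure Omega, continuous u}) (MA : monge_ampere_le Omega u Lam)
  (uK : forall x, boundary Omega x -> `|u x| <= K)
  (Hp : forall x, boundary Omega x -> xlast x < tau ->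
     `|u x - (u 0 + dotv bp (xprime x))| <= M * dotv (xprime x) (xprime x))
  (bpM : dotv bp bp <= M).

(** The first term pays for the pinching error where x_n < tau, the second for u(0), u and bp.x'
    where x_n >= tau, the third for the quadratic part of the barrier. The 4 K in the second also
    covers the upper bound of [axis_supporting_le]. *)
Definition slope_bound : R :=
  M / kappa + (4 * K + M + kappa^-1 / kappa) / tau + (Lam + 1) / 2 / kappa.

Lemma K_ge0 : 0 <= K.
Proof. exact: le_trans (normr_ge0 _) (uK bd0). Qed.

Lemma cvx_fun_interior : cvx_fun Omega u.
Proof. by move=> x y t Ox Oy; apply: cu; exact: subset_closure. Qed.

Lemma lower_barrier : supporting Omega u 0 (mkpt bp (- slope_bound)).
Proof.
(* The Hessian of the barrier is Lam + 1 times the identity, so its determinant exceeds Lam in every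
   dimension. *)
pose b := (Lam + 1) / 2; have b0 : 0 < b by rewrite divr_gt0 // ltr_wpDl.
have K0 := K_ge0.
have cge0 x : closure Omega x -> 0 <= xlast x.
  exact: (xlast_closure_ge0 m_gt0 oO posO kappa_gt0 kO).
pose w x := u 0 + dotv (mkpt bp (- slope_bound)) x + b * dotv (xprime x) (xprime x)
  + b * xlast x ^+ 2.
have ki : 0 < kappa^-1 by rewrite invr_gt0.
have dE x : dotv (mkpt bp (- slope_bound)) x =
    dotv bp (xprime x) - slope_bound * xlast x.
  by rewrite -{1}(mkptK x) dotv_mkpt mulNr.
have w_bd x : boundary Omega x -> w x <= u x.
  move=> bx; have cx := bx.1; have x0 := cge0 _ cx.
  have kx : dotv x x <= xlast x * kappa^-1 by rewrite ler_pdivlMr // mulrC; exact: kO.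
  have px : dotv (xprime x) (xprime x) <= xlast x * kappa^-1.
    exact: (dotv_xprime_le m_gt0 oO posO kappa_gt0 kO).
  have wE : w x = u 0 + dotv bp (xprime x) - slope_bound * xlast x + b * dotv x x.
    by rewrite /w dE [dotv x x]dotv_xprime; ring.
  have bk : b * dotv x x <= b * (xlast x * kappa^-1) by rewrite ler_pM2l.
  rewrite wE.
  pose c1 := (4 * K + M + kappa^-1 / kappa) / tau.
  have c10 : 0 <= c1.
    by rewrite divr_ge0 ?(ltW tau_gt0) // !addr_ge0 ?mulr_ge0 // ltW.
  have sE : slope_bound * xlast x = M * (xlast x * kappa^-1) + c1 * xlast x
      + b * (xlast x * kappa^-1).
    by rewrite /slope_bound -/c1 -/b; ring.
  have [xt|tx] := ltP (xlast x) tau.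
    have := Hp bx xt; rewrite ler_norml => /andP[H _].
    have : M * dotv (xprime x) (xprime x) <= M * (xlast x * kappa^-1) by rewrite ler_pM2l.
    have : 0 <= c1 * xlast x by rewrite mulr_ge0.
    rewrite sE; lra.
  have : c1 * tau <= c1 * xlast x by rewrite ler_wpM2l.
  have -> : c1 * tau = 4 * K + M + kappa^-1 / kappa.
    by rewrite /c1 divfK // gt_eqF.
  have M0 : 0 <= M * (xlast x * kappa^-1) by rewrite !mulr_ge0 // ltW.
  have := uK bx; have := uK bd0; rewrite !ler_norml => /andP[_ H1] /andP[H2 _].
  have := @normr_dotv_le R m bp (xprime x); rewrite ler_norml => /andP[_ H3].
  have := xlast_le m_gt0 oO posO kappa_gt0 kO cx => xk.
  have : xlast x * kappa^-1 <= kappa^-1 / kappa by rewrite ler_wpM2r // ltW.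
  have : 0 <= kappa^-1 / kappa by rewrite divr_ge0 // ltW.
  have := bpM; have := M_gt0; rewrite sE; lra.
have w_O x : Omega x -> w x <= u x.
  apply: (@comparison_cylindric _ _ Omega Omega (closure Omega) u Lam (u 0)
    (kappa^-1 / kappa) b b) => //.
  - exact: cvx_fun_interior.
  - exact: closed_closure.
  - exact: (dotv_closure_le m_gt0 oO posO kappa_gt0 kO).
  - exact: subset_closure.
  - rewrite (_ : 2 * b = Lam + 1); last by rewrite /b; field.
    have L0 := Lam_ge0; rewrite -exprSr; apply: (@lt_le_trans _ _ (Lam + 1)); first lra.
    by rewrite exprS ler_pMr ?exprn_ege1 //; lra.
  - by move=> y cy nOy; apply: w_bd; apply/boundaryE.
move=> x cx; rewrite subr0; apply: (@le_trans _ _ (w x)).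
  by rewrite /w -addrA lerDl addr_ge0 // mulr_ge0 ?sqr_ge0 ?dotv_ge0 // ltW.
have [/w_O//|nOx] := pselect (Omega x).
by apply: w_bd; apply/boundaryE.
Qed.

Lemma axis_supporting_le g : supporting Omega u 0 g -> xlast g <= 4 * K / tau.
Proof.
move=> sg; have t2 : 0 < tau / 2 by rewrite divr_gt0.
have t2t : tau / 2 < tau by rewrite ltr_pdivrMr // ltr_pMr // ltr1n.
have Oz := axis_sub oO cO posO bd0 M_gt0 Hq t2 t2t.
have cz := subset_closure Oz; have := sg _ cz.
rewrite subr0 -{1}(mkptK g) dotv_mkpt dotv0r add0r.
have := cvx_fun_le_boundary m_gt0 oO posO kappa_gt0 kO cu
  (fun x bx => le_trans (ler_norm _) (uK bx)) cz.
have := uK bd0; rewrite ler_norml => /andP[h1 _] h2 h3.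
rewrite ler_pdivlMr //; lra.
Qed.

Lemma boundary_gradient_ex : exists g, boundary_gradient Omega u 0 (e_last R m) g.
Proof.
have t2 : 0 < tau / 2 by rewrite divr_gt0.
have t2t : tau / 2 < tau by rewrite ltr_pdivrMr // ltr_pMr // ltr1n.
have Oz := axis_sub oO cO posO bd0 M_gt0 Hq t2 t2t.
apply: (boundary_gradient_exists _ (subset_closure Oz) _ lower_barrier).
  exact: (xlast_closure_ge0 m_gt0 oO posO kappa_gt0 kO).
by rewrite xlast_mkpt.
Qed.

(** Test at boundary points over t d, d = g' - bp. Their height is O(t^2), so both the normal term
    and the pinching error are quadratic, with total constant [L], and cannot compensate t |d|^2. *)
Lemma supporting_xprime g : supporting Omega u 0 g -> xprime g = bp.
Proof.
move=> sg; apply/eqP; rewrite -subr_eq0; apply/negPn/negP => d0.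
set d := xprime g - bp in d0; set N := dotv d d.
have N0 : 0 < N by rewrite dotv_gt0.
pose L := M * (1 + `|xlast g|).
have L0 : 0 < L by rewrite mulr_gt0 // ltr_pwDl.
have [s [t [/andP[s0 st] t0 Lt bt]]] :=
  axis_exit_small m_gt0 oO cO posO bd0 kappa_gt0 kO M_gt0 tau_gt0 Hq L0 d0.
have := Hp bt; rewrite xlast_mkpt xprime_mkpt => /(_ st).
rewrite ler_norml => /andP[_].
have := sg _ bt.1; rewrite subr0 -{1}(mkptK g) dotv_mkpt.
have := boundary_xlast_le m_gt0 oO cO posO bd0 kappa_gt0 kO M_gt0 tau_gt0 Hq bt.
rewrite xlast_mkpt xprime_mkpt !(dotvZl, dotvZr) -/N => /(_ st) sN h1 h2.
have gd : dotv (xprime g) d = dotv bp d + N.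
  by rewrite -dotvDl addrC subrK.
rewrite gd in h1.
have h3 : - (`|xlast g| * (M * (t * (t * N)))) <= xlast g * s.
  apply: (@le_trans _ _ (- (`|xlast g| * s))).
    by rewrite lerN2 ler_wpM2l.
  by rewrite -mulNr; apply: ler_wpM2r; [exact: ltW|rewrite lerNl -normrN ler_norm].
have h : 0 < 1 - L * t by rewrite subr_gt0.
have := mulr_gt0 (mulr_gt0 t0 N0) h; rewrite /L; lra.
Qed.

(** Were g_n below the slope of the lower barrier, that barrier would be a supporting plane with the
    same tangential part and a larger normal slope. *)
Lemma boundary_gradient_bound g : boundary_gradient Omega u 0 (e_last R m) g ->
  xprime g = bp /\ `|xlast g| <= slope_bound.
Proof.
move=> [sg mg]; have gp := supporting_xprime sg; split => //.
have K0 := K_ge0.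
have ki : 0 < kappa^-1 by rewrite invr_gt0.
have B1 : 4 * K / tau <= slope_bound.
  rewrite /slope_bound addrAC -[leLHS]add0r lerD //.
    by rewrite addr_ge0 // mulr_ge0 // ?divr_ge0 // ?addr_ge0 // ltW.
  rewrite ler_pM2r ?invr_gt0 // -addrA lerDl addr_ge0 // ?mulr_ge0 // ltW //.
rewrite ler_norml (le_trans (axis_supporting_le sg) B1) andbT leNgt.
apply/negP => gB; apply: (mg (- slope_bound - xlast g)); first by rewrite subr_gt0.
have -> : g + (- slope_bound - xlast g) *: e_last R m = mkpt bp (- slope_bound).
  rewrite -{1}(mkptK g) gp e_lastE mkptZ mkptD scaler0 addr0 mulr1.
  by congr mkpt; lra.
exact: lower_barrier.
Qed.

End gradient.

(** * Growth along the normal *)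

Lemma cvx_fun_weighted (R : realType) (n : nat) (A : set 'rV[R]_n) (v : 'rV[R]_n -> R)
    (p q : R) (x y z : 'rV[R]_n) : cvx_fun A v -> A x -> A y ->
  0 <= p -> 0 <= q -> 0 < p + q -> (p + q) *: z = p *: x + q *: y ->
  (p + q) * v z <= p * v x + q * v y.
Proof.
move=> cv Ax Ay p0 q0 pq0 zE.
have pq_neq0 : p + q != 0 by rewrite gt_eqF.
have t01 : 0 <= q / (p + q) <= 1.
  by rewrite divr_ge0 ?(ltW pq0) //= ler_pdivrMr // mul1r lerDr.
have t1E : 1 - q / (p + q) = p / (p + q) by field.
have zE' : z = (1 - q / (p + q)) *: x + (q / (p + q)) *: y.
  have -> : z = (p + q)^-1 *: ((p + q) *: z) by rewrite scalerA mulVf // scale1r.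
  by rewrite t1E zE scalerDr !scalerA ![_^-1 * _]mulrC.
have := cv x y _ Ax Ay t01; rewrite -zE' t1E => H.
have -> : p * v x + q * v y = (p + q) * (p / (p + q) * v x + q / (p + q) * v y).
  by field.
by rewrite ler_pM2l.
Qed.

(** On the low part of the boundary v <= 2 N |x'|^2, and |x'|^2 <= x_n / kappa. *)
Definition boundary_slope (R : realType) (kappa N : R) : R := 2 * N / kappa.

(** Since x_n <= M |x'|^2 on the low boundary, a slope eps = [slab_slope] times a costs at most (a
    kappa / 32) |x'|^2 there. *)
Definition slab_slope (R : realType) (kappa M : R) : R := kappa / (32 * M).

(** The height at which the smallness hypothesis of [slice_v_ge], with s = t / h, is an equality. *)
Definition slab_height (R : realType) (kappa M N a t : R) : R :=
  4 * M * boundary_slope kappa N ^+ 2 / kappa * t / a ^+ 2.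

Definition growth_threshold (R : realType) (m : nat)
    (kappa M N Lam tau theta beta cs : R) : Prop :=
  forall a t : R, 0 < a -> a <= boundary_slope kappa N -> 0 < t ->
  t <= cs * a `^ beta ->
  let h := slab_height kappa M N a t in
  [/\ h < tau, N * (h / kappa) `^ theta <= a * kappa / 4 &
      Lam * h < (a * kappa / 4) ^+ m * (2 * (slab_slope kappa M * a))].

(** Since h is a multiple of t / a^2, the hypothesis on t gives h <= c0 cs a^(m+1) a^(1/theta). The
    error condition uses the factor a^(1/theta), the determinant condition the factor a^(m+1); the
    spare factor is bounded because a <= [boundary_slope]. *)
Lemma growth_threshold_ex (R : realType) (m : nat) (kappa M N Lam tau theta : R) :
  0 < kappa -> 0 < M -> 0 < N -> 0 <= Lam -> 0 < tau -> 0 < theta ->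
  exists2 cs, 0 < cs &
    growth_threshold m kappa M N Lam tau theta (m%:R + 3 + theta^-1) cs.
Proof.
move=> k0 M0 N0 L0 tau0 th0; set B := boundary_slope kappa N.
have B0 : 0 < B by rewrite divr_gt0 // mulr_gt0.
pose c0 := 4 * M * B ^+ 2 / kappa.
have c00 : 0 < c0 by rewrite divr_gt0 // mulr_gt0 ?exprn_gt0 // mulr_gt0.
pose G := B ^+ m.+1; pose H := B `^ theta^-1.
have G0 : 0 < G by rewrite exprn_gt0.
have H0 : 0 < H by rewrite powR_gt0.
pose k1 := (kappa / (4 * N)) `^ theta^-1.
have k10 : 0 < k1 by rewrite powR_gt0 // divr_gt0 // mulr_gt0.
pose k2 := (kappa / 4) ^+ m * (2 * slab_slope kappa M).
have k20 : 0 < k2.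
  apply: mulr_gt0; first by rewrite exprn_gt0 // divr_gt0.
  by apply: mulr_gt0 => //; rewrite divr_gt0 // mulr_gt0.
(* One constant per condition. The factors 2 make the first and third strict, and Lam + 1 avoids
   dividing by zero. *)
pose e1 := tau / (2 * c0 * G * H); pose e2 := kappa * k1 / (c0 * G).
pose e3 := k2 / (2 * (Lam + 1) * c0 * H).
have L1 : 0 < Lam + 1 by rewrite ltr_wpDl.
have e10 : 0 < e1 by do ?[by [] | apply: divr_gt0 | apply: mulr_gt0].
have e20 : 0 < e2 by do ?[by [] | apply: divr_gt0 | apply: mulr_gt0].
have e30 : 0 < e3 by do ?[by [] | apply: divr_gt0 | apply: mulr_gt0].
exists (Num.min e1 (Num.min e2 e3)); first by rewrite !lt_min e10 e20 e30.
set cs := Num.min _ _ => a t a0 aB t0 tcs h.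
have cs1 : cs <= e1 by rewrite ge_min lexx.
have cs2 : cs <= e2 by rewrite !ge_min lexx orbT.
have cs3 : cs <= e3 by rewrite !ge_min lexx !orbT.
have cs0 : 0 < cs by rewrite !lt_min e10 e20 e30.
set q := a ^+ m.+1; set p := a `^ theta^-1.
have q0 : 0 < q by rewrite exprn_gt0.
have p0 : 0 < p by rewrite powR_gt0.
have qG : q <= G by rewrite lerXn2r // nnegrE ltW.
have pH : p <= H by apply: ge0_ler_powR; rewrite ?nnegrE ?invr_ge0 // ltW.
have abeta : a `^ (m%:R + 3 + theta^-1) = a ^+ 2 * q * p.
  rewrite powRD; last by rewrite (gt_eqF a0) implybT.
  congr (_ * _); rewrite /q -exprD addnC addSnnS -powR_mulrn ?(ltW a0) //.
  by rewrite natrD.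
have h0 : 0 < h by rewrite divr_gt0 ?exprn_gt0 // mulr_gt0.
have hcs : h <= c0 * cs * q * p.
  rewrite ler_pdivrMr ?exprn_gt0 // -/B -/c0.
  have -> : c0 * cs * q * p * a ^+ 2 = c0 * (cs * (a ^+ 2 * q * p)) by ring.
  by rewrite ler_pM2l // -abeta.
clearbody c0; split.
- have qp : q * p <= G * H by apply: ler_pM => //; exact: ltW.
  apply: (@le_lt_trans _ _ (c0 * e1 * G * H)).
    apply: le_trans hcs _.
    rewrite [leLHS](_ : _ = c0 * (cs * (q * p))); last by ring.
    rewrite [leRHS](_ : _ = c0 * (e1 * (G * H))); last by ring.
    rewrite ler_pM2l //.
    by apply: ler_pM => //; apply/ltW => //; rewrite mulr_gt0.
  have -> : c0 * e1 * G * H = tau / 2.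
    by rewrite /e1; field; rewrite !gt_eqF.
  by rewrite ltr_pdivrMr // ltr_pMr // ltr1n.
- have hk : h / kappa <= k1 * p.
    rewrite ler_pdivrMr //; apply: le_trans hcs _.
    have -> : k1 * p * kappa = c0 * e2 * G * p.
      by rewrite /e2; field; rewrite !gt_eqF.
    rewrite ler_pM2r // [leLHS](_ : _ = c0 * (cs * q)); last by ring.
    rewrite [leRHS](_ : _ = c0 * (e2 * G)); last by ring.
    by rewrite ler_pM2l //; apply: ler_pM => //; exact: ltW.
  have : (h / kappa) `^ theta <= (k1 * p) `^ theta.
    apply: ge0_ler_powR => //; first exact: ltW.
      by rewrite nnegrE ltW // divr_gt0.
    by rewrite nnegrE ltW // mulr_gt0.
  have -> : (k1 * p) `^ theta = kappa / (4 * N) * a.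
    rewrite powRM ?ltW // /k1 /p -!powRrM mulVf ?gt_eqF //.
    by rewrite !powRr1 // ?ltW // divr_gt0 // mulr_gt0.
  move=> H1; apply: (@le_trans _ _ (N * (kappa / (4 * N) * a))).
    by rewrite ler_pM2l.
  by rewrite le_eqVlt; apply/orP; left; apply/eqP; field; rewrite gt_eqF.
- have hq : Lam * h <= (Lam + 1) * (c0 * e3 * q * H).
    apply: ler_pM => //; [exact: ltW|by rewrite lerDl|].
    apply: le_trans hcs _.
    rewrite [leLHS](_ : _ = c0 * (cs * (q * p))); last by ring.
    rewrite [leRHS](_ : _ = c0 * (e3 * (q * H))); last by ring.
    rewrite ler_pM2l //.
    apply: ler_pM => //; [exact: ltW|by apply/ltW; rewrite mulr_gt0|].
    by rewrite ler_pM2l.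
  apply: le_lt_trans hq _.
  have -> : (Lam + 1) * (c0 * e3 * q * H) = k2 * q / 2.
    by rewrite /e3; field; rewrite !gt_eqF.
  have -> : (a * kappa / 4) ^+ m * (2 * (slab_slope kappa M * a)) = k2 * q.
    by rewrite /k2 /q exprS -(mulrA a) exprMn; ring.
  have kq : 0 < k2 * q by rewrite mulr_gt0.
  lra.
Qed.

(** * Power growth of v on the axis and its extension to the whole domain *)

Section axis_growth.
Context (R : realType) (m : nat) (Omega : set 'rV[R]_m.+1) (kappa : R).
Hypotheses (m_gt0 : (0 < m)%N) (oO : open Omega) (cO : cvx_set Omega)
  (posO : forall x, Omega x -> 0 < xlast x) (bd0 : boundary Omega 0)
  (kappa_gt0 : 0 < kappa) (kappa_le1 : kappa <= 1)
  (kO : forall x, boundary Omega x -> kappa * dotv x x <= xlast x).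
Context (M tau : R) (bq : 'rV[R]_m).
Hypotheses (M_ge1 : 1 <= M) (tau_gt0 : 0 < tau) (tau_le : tau <= kappa)
  (Hq : forall x, boundary Omega x -> xlast x < tau ->
     `|xlast x - dotv bq (xprime x)| <= M * dotv (xprime x) (xprime x)).
Context (v : 'rV[R]_m.+1 -> R) (F : 'rV[R]_m -> R) (N theta : R).
Hypotheses (cv : cvx_fun (closure Omega) v) (v00 : v 0 = 0)
  (v_ge0 : forall x, closure Omega x -> 0 <= v x)
  (N_ge1 : 1 <= N) (theta_gt0 : 0 < theta)
  (FZ : forall t y, F (t *: y) = t ^+ 2 * F y)
  (FN : forall y, F y <= N * dotv y y)
  (vF : forall x, boundary Omega x -> xlast x < tau ->
     `|v x - F (xprime x)| <=
     N * (dotv (xprime x) (xprime x) * dotv (xprime x) (xprime x) `^ theta)).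

Let M_gt0 : 0 < M := lt_le_trans ltr01 M_ge1.
Let N_gt0 : 0 < N := lt_le_trans ltr01 N_ge1.

Local Lemma xprime_sq_le x : closure Omega x -> dotv (xprime x) (xprime x) <= xlast x / kappa.
Proof. exact: (dotv_xprime_le m_gt0 oO posO kappa_gt0 kO). Qed.

Local Lemma xlast_ge0 x : closure Omega x -> 0 <= xlast x.
Proof. exact: (xlast_closure_ge0 m_gt0 oO posO kappa_gt0 kO). Qed.

Local Lemma xlast_boundary_le x : boundary Omega x -> xlast x < tau ->
  xlast x <= M * dotv (xprime x) (xprime x).
Proof. exact: (boundary_xlast_le m_gt0 oO cO posO bd0 kappa_gt0 kO M_gt0 tau_gt0 Hq). Qed.

Local Lemma axis_in s : 0 < s -> s < tau -> Omega (mkpt 0 s).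
Proof. exact: (axis_sub oO cO posO bd0 M_gt0 Hq). Qed.

Local Lemma boundary_slope_gt0 : 0 < boundary_slope kappa N.
Proof. by rewrite divr_gt0 // mulr_gt0. Qed.

Lemma boundary_growth x : boundary Omega x -> xlast x < tau ->
  v x <= boundary_slope kappa N * xlast x.
Proof.
move=> bx xt; have := vF bx xt; rewrite ler_norml => /andP[_].
have := xprime_sq_le bx.1; have := FN (xprime x); have := dotv_ge0 (xprime x).
set d := dotv _ _ => d0 Fd dk.
have d1 : d <= 1.
  apply: (le_trans dk); rewrite ler_pdivrMr // mul1r.
  exact: le_trans (ltW xt) tau_le.
have p1 : d `^ theta <= 1.
  have : d `^ theta <= 1 `^ theta by apply: ge0_ler_powR; rewrite ?nnegrE // ltW.
  by rewrite powR1.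
have h1 : N * (d * d `^ theta) <= N * d by rewrite ler_pM2l // ler_piMr.
have h2 : N * d <= N * (xlast x / kappa) by rewrite ler_pM2l.
have -> : boundary_slope kappa N * xlast x = 2 * (N * (xlast x / kappa)).
  by rewrite /boundary_slope; ring.
lra.
Qed.

Lemma ray_le s x : 0 <= s -> s <= 1 -> closure Omega x -> v (s *: x) <= s * v x.
Proof.
move=> s0 s1 cx; have := cv bd0.1 cx (t := s).
by rewrite s0 s1 scaler0 add0r v00 mulr0 add0r; apply.
Qed.

Lemma axis_two_exits (e : 'rV[R]_m) s : 0 < s -> s < tau -> e != 0 ->
  exists r1 r2, [/\ 0 < r1, 0 < r2, boundary Omega (mkpt (r1 *: e) s),
    boundary Omega (mkpt (- r2 *: e) s) &
    (r1 + r2) * v (mkpt 0 s) <=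
      r2 * v (mkpt (r1 *: e) s) + r1 * v (mkpt (- r2 *: e) s)].
Proof.
move=> s0 st e0; have [r1 r10 b1] := exit_horizontal oO posO kappa_gt0 kO (axis_in s0 st) e0.
have [|r2 r20 b2] := exit_horizontal (e := - e) oO posO kappa_gt0 kO (axis_in s0 st).
  by rewrite oppr_eq0.
rewrite add0r in b1; rewrite add0r scalerN -scaleNr in b2.
exists r1, r2; split=> //; rewrite [r1 + r2]addrC.
apply: (cvx_fun_weighted cv b1.1 b2.1); rewrite ?addr_gt0 ?(ltW r10) ?(ltW r20) //.
rewrite !mkptZ mkptD !scalerA -scalerDl mulrN (mulrC r2) subrr scaler0 scale0r.
by rewrite -mulrDl.
Qed.

Lemma axis_linear_le s : 0 < s -> s < tau -> v (mkpt 0 s) <= boundary_slope kappa N * s.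
Proof.
move=> s0 st.
have [r1 [r2 [r10 r20 b1 b2 H]]] := axis_two_exits s0 st (ones_neq0 R m_gt0).
have := boundary_growth b1; have := boundary_growth b2; rewrite !xlast_mkpt.
move=> /(_ st) h2 /(_ st) h1.
have := ler_wpM2l (ltW r20) h1; have := ler_wpM2l (ltW r10) h2 => h3 h4.
have r12 : 0 < r1 + r2 by rewrite addr_gt0.
by rewrite -(ler_pM2l r12); lra.
Qed.

(** On the chord in direction e, with half-lengths r1 and r2, convexity gives a s <= F(e) r1 r2 plus
    an error of at most a s / 2. Unequal half-lengths do no harm, since r1 r2 |e|^2 <= s / kappa. *)
Lemma quadratic_separation (a s : R) (e : 'rV[R]_m) : 0 < s -> s < tau ->
  a * s <= v (mkpt 0 s) -> N * (s / kappa) `^ theta <= a * kappa / 2 ->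
  a * kappa / 2 * dotv e e <= F e.
Proof.
move=> s0 st as_le sa.
have [->|e0] := eqVneq e 0.
  by have := FZ 0 0; rewrite scale0r expr0n mul0r dotv0l mulr0 => ->.
set d := dotv e e; have d0 : 0 < d by rewrite dotv_gt0.
have [r1 [r2 [r10 r20 b1 b2 H]]] := axis_two_exits s0 st e0.
have sk : 0 <= s / kappa by rewrite divr_ge0 // ltW.
have side r : boundary Omega (mkpt (r *: e) s) ->
    r ^+ 2 * d <= s / kappa /\ v (mkpt (r *: e) s) <= F e * r ^+ 2 + a * s / 2.
  move=> br; have := vF br; have := xprime_sq_le br.1.
  rewrite xlast_mkpt xprime_mkpt !(dotvZl, dotvZr) FZ -/d !mulrA -expr2.
  move=> rd /(_ st); rewrite ler_norml => /andP[_ H1]; split => //.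
  have rd0 : 0 <= r ^+ 2 * d by rewrite mulr_ge0 ?sqr_ge0 // ltW.
  have p1 : (r ^+ 2 * d) `^ theta <= (s / kappa) `^ theta.
    by apply: ge0_ler_powR; rewrite ?nnegrE // ltW.
  have h1 : N * (r ^+ 2 * d) * (r ^+ 2 * d) `^ theta <=
      N * (s / kappa) * (s / kappa) `^ theta.
    apply: ler_pM => //; last by rewrite ler_pM2l.
      by rewrite mulr_ge0 // ltW.
    exact: powR_ge0.
  have h2 : s / kappa * (N * (s / kappa) `^ theta) <= s / kappa * (a * kappa / 2).
    by rewrite ler_wpM2l.
  have h3 : s / kappa * (a * kappa / 2) = a * s / 2 by field; rewrite gt_eqF.
  rewrite h3 in h2; lra.
have [d1 v1] := side _ b1; have [d2 v2] := side _ b2.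
have h1 := ler_wpM2l (ltW r20) v1; have h2 := ler_wpM2l (ltW r10) v2.
have r12 : 0 < r1 + r2 by rewrite addr_gt0.
have h3 := ler_wpM2l (ltW r12) as_le.
have h4 : a * s / 2 <= F e * (r1 * r2).
  rewrite -(ler_pM2l r12); rewrite sqrrN in h2; lra.
have h5 : r1 * r2 * d <= s / kappa.
  have : 0 <= (r1 - r2) ^+ 2 * d by rewrite mulr_ge0 ?sqr_ge0 // ltW.
  rewrite sqrrN in d2; lra.
have a0 : 0 <= a.
  have : 0 <= a * kappa / 2 by apply: le_trans sa; rewrite mulr_ge0 ?powR_ge0 // ltW.
  by rewrite pmulr_lge0 // pmulr_lge0.
rewrite leNgt; apply/negP => Fe.
have rr : 0 < r1 * r2 by rewrite mulr_gt0.
have h6 : F e * (r1 * r2) < a * kappa / 2 * d * (r1 * r2) by rewrite ltr_pM2r.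
have h7 : a * kappa / 2 * (r1 * r2 * d) <= a * kappa / 2 * (s / kappa).
  by rewrite ler_wpM2l // !mulr_ge0 // ltW.
have h8 : a * kappa / 2 * (s / kappa) = a * s / 2 by field; rewrite gt_eqF.
lra.
Qed.

(** The chord at height t joins s x, through the axis, to a boundary point over -r e, where v <= B
    t. Tangency bounds r from below, r^2 >= s kappa / M, so the smallness hypothesis yields s B <= r
    a / 2: the far end uses up at most half of the value on the axis. *)
Lemma slice_v_ge (a t s h : R) x : 0 <= a -> 0 < t -> t < tau -> 0 < s -> s <= 1 ->
  s * h = t -> a * t <= v (mkpt 0 t) ->
  4 * M * s * boundary_slope kappa N ^+ 2 <= kappa * a ^+ 2 ->
  closure Omega x -> xlast x = h -> a * h / 2 <= v x.
Proof.
move=> a0 t0 tt s0 s1 sh at_le cond cx xh; set B := boundary_slope kappa N in cond.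
have h0 : 0 < h by rewrite -(pmulr_rgt0 _ s0) sh.
have sx := ray_le (ltW s0) s1 cx.
suff H : a * t / 2 <= v (s *: x) by rewrite -(ler_pM2l s0); rewrite -[in X in X <= _]sh in H; lra.
have xE : x = mkpt (xprime x) h by rewrite -xh mkptK.
have sxE : s *: x = mkpt (s *: xprime x) t by rewrite xE mkptZ xprime_mkpt sh.
have [e0|e0] := eqVneq (xprime x) 0.
  rewrite sxE e0 scaler0; apply: le_trans at_le; rewrite ler_pdivrMr //.
  by have := mulr_ge0 a0 (ltW t0); lra.
set e := xprime x in e0 sxE *.
have [|r r0 br] := exit_horizontal (e := - e) oO posO kappa_gt0 kO (axis_in t0 tt).
  by rewrite oppr_eq0.
rewrite add0r scalerN in br.
have csx : closure Omega (s *: x).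
  have := cvx_set_closure cO bd0.1 cx (t := s).
  by rewrite (ltW s0) s1 scaler0 add0r; apply.
have H : (s + r) * v (mkpt 0 t) <= s * v (mkpt (- (r *: e)) t) + r * v (s *: x).
  apply: (cvx_fun_weighted cv br.1 csx); rewrite ?addr_gt0 ?(ltW s0) ?(ltW r0) //.
  rewrite sxE !mkptZ mkptD scaler0 scalerN !scalerA (mulrC s r) addNr.
  by rewrite -mulrDl.
have vbr : v (mkpt (- (r *: e)) t) <= B * t.
  by have := boundary_growth br; rewrite xlast_mkpt => /(_ tt).
have tM : t <= M * (r ^+ 2 * dotv e e).
  have := xlast_boundary_le br; rewrite xlast_mkpt xprime_mkpt => /(_ tt).
  by rewrite !(dotvNl, dotvNr, dotvZl, dotvZr); lra.
have eh : kappa * dotv e e <= h.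
  by rewrite -xh mulrC -ler_pdivlMr //; exact: xprime_sq_le.
have B0 : 0 < B := boundary_slope_gt0.
clearbody B.
have skM : s * kappa <= M * r ^+ 2.
  have h1 : M * r ^+ 2 * (kappa * dotv e e) <= M * r ^+ 2 * h.
    by rewrite ler_pM2l // mulr_gt0 // exprn_gt0.
  have h2 : kappa * t <= kappa * (M * (r ^+ 2 * dotv e e)) by rewrite ler_pM2l.
  rewrite -(ler_pM2r h0); rewrite -sh in h2; lra.
have sB : s * B <= r * a / 2.
  have h1 : M * s * s * B ^+ 2 * 4 <= s * (kappa * a ^+ 2).
    have := ler_wpM2l (ltW s0) cond; lra.
  have h2 : s * kappa * a ^+ 2 <= M * r ^+ 2 * a ^+ 2 by rewrite ler_wpM2r // sqr_ge0.
  have h3 : M * (4 * (s * B) ^+ 2) <= M * (r * a) ^+ 2 by rewrite !exprMn; lra.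
  rewrite ler_pM2l // in h3.
  have ra0 : 0 <= r * a by rewrite mulr_ge0 // ltW.
  have sB0 : 0 < s * B by rewrite mulr_gt0.
  rewrite leNgt; apply/negP => lt1; nra.
have h1 := ler_wpM2l (ltW s0) vbr.
have h2 : s * (B * t) <= r * a / 2 * t by rewrite mulrA ler_pM2r.
have h3 : (s + r) * (a * t) <= (s + r) * v (mkpt 0 t) by rewrite ler_pM2l // addr_gt0.
have h4 : 0 <= s * (a * t) by rewrite !mulr_ge0 // ltW.
rewrite -(ler_pM2l r0); lra.
Qed.

Context (Lam : R) (u : 'rV[R]_m.+1 -> R) (g : 'rV[R]_m.+1).
Hypotheses (Lam_ge0 : 0 <= Lam) (cu : cvx_fun Omega u)
  (uc : {within closure Omega, continuous u}) (MA : monge_ampere_le Omega u Lam)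
  (vE : forall x, v x = u x - u 0 - dotv g x)
  (v_lt : forall eps : R, 0 < eps -> exists2 x, closure Omega x & v x < eps * xlast x).

(* If the growth rate a persisted from the scale h down to the scale t, then
   eps x_n + b |x'|^2 + A x_n^2 would lie below v on the boundary of the slab
   {x_n < h}, and eps x_n <= v would contradict the maximality of the slope. *)
Lemma no_linear_growth (a t h : R) : 0 < a -> 0 < t -> t <= h -> h < tau ->
  a * t <= v (mkpt 0 t) -> 4 * M * (t / h) * boundary_slope kappa N ^+ 2 <= kappa * a ^+ 2 ->
  N * (h / kappa) `^ theta <= a * kappa / 4 ->
  Lam * h < (a * kappa / 4) ^+ m * (2 * (slab_slope kappa M * a)) -> False.
Proof.
move=> a0 t0 th ht at_le cond1 cond2 cond3.
have h0 : 0 < h := lt_le_trans t0 th.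
have tt : t < tau := le_lt_trans th ht.
set c := slab_slope kappa M in cond3.
have c0 : 0 < c by rewrite divr_gt0 // mulr_gt0.
have c1 : c <= 1 / 32.
  rewrite ler_pdivrMr ?mulr_gt0 // mulrA divfK ?gt_eqF // mul1r.
  exact: le_trans kappa_le1 M_ge1.
have cM : c * M = kappa / 32 by rewrite /c /slab_slope; field; rewrite gt_eqF.
have hk : 0 <= h / kappa by rewrite divr_ge0 // ltW.
have sep e : a * kappa / 2 * dotv e e <= F e.
  apply: (@quadratic_separation a t) => //.
  apply: (@le_trans _ _ (N * (h / kappa) `^ theta)).
    rewrite ler_pM2l //; apply: ge0_ler_powR; rewrite ?nnegrE ?(ltW theta_gt0) //.
      by rewrite divr_ge0 // ltW.
    by rewrite ler_pM2r // invr_gt0.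
  by have := mulr_gt0 a0 kappa_gt0; lra.
have bd_ge x : boundary Omega x -> xlast x <= h ->
    a * kappa / 4 * dotv (xprime x) (xprime x) <= v x.
  move=> bx xh; have := vF bx (le_lt_trans xh ht); rewrite ler_norml => /andP[H _].
  have := sep (xprime x); have := xprime_sq_le bx.1; have := dotv_ge0 (xprime x).
  move: H; set d := dotv _ _ => H d0 dk sd.
  have : N * (d * d `^ theta) <= d * (a * kappa / 4).
    rewrite mulrCA ler_wpM2l //; apply: le_trans cond2; rewrite ler_pM2l //.
    apply: ge0_ler_powR; rewrite ?nnegrE ?(ltW theta_gt0) //.
    by apply: le_trans dk _; rewrite ler_pM2r // invr_gt0.
  lra.
(* [b] takes half of the coefficient a kappa / 4 available on the boundary. The other half covers
   eps x_n + A x_n^2 <= 2 eps x_n, which holds because A h = eps. *)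
pose b := a * kappa / 8; pose eps := c * a; pose A := c * a / h.
have b0 : 0 < b by rewrite divr_gt0 // mulr_gt0.
have A0 : 0 < A by rewrite divr_gt0 // mulr_gt0.
have eps0 : 0 < eps by rewrite mulr_gt0.
pose w (x : 'rV[R]_m.+1) := eps * xlast x + b * dotv (xprime x) (xprime x) + A * xlast x ^+ 2.
have Ah : A * h = eps by rewrite divfK // gt_eqF.
have w_bd x : boundary Omega x -> xlast x <= h -> w x <= v x.
  move=> bx xh; apply: le_trans (bd_ge _ bx xh).
  have x0 := xlast_ge0 bx.1; have := xlast_boundary_le bx (le_lt_trans xh ht).
  have := dotv_ge0 (xprime x); rewrite /w; set d := dotv _ _; set s := xlast x in x0 xh *.
  move=> d0 sd.
  have h1 : A * s ^+ 2 <= eps * s.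
    by rewrite -Ah expr2 !mulrA ler_wpM2r // ler_pM2l.
  have h2 : eps * s <= a * (kappa / 32) * d.
    rewrite -cM; have -> : a * (c * M) * d = eps * (M * d) by rewrite /eps; ring.
    by rewrite ler_pM2l.
  have h3 : 0 <= a * kappa * d by rewrite !mulr_ge0 // ltW.
  rewrite /b; lra.
have w_top x : closure Omega x -> xlast x = h -> w x <= v x.
  move=> cx xh.
  apply: le_trans (slice_v_ge (s := t / h) (ltW a0) t0 tt _ _ _ at_le _ cx xh) => //.
  - rewrite /w xh; have := xprime_sq_le cx; rewrite xh => dk.
    have h1 : b * dotv (xprime x) (xprime x) <= a * h / 8.
      apply: (@le_trans _ _ (b * (h / kappa))); first by rewrite ler_pM2l.
      by rewrite /b; have -> : a * kappa / 8 * (h / kappa) = a * h / 8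
        by field; rewrite gt_eqF.
    have h2 : A * h ^+ 2 = eps * h by rewrite expr2 mulrA Ah.
    have h3 : eps * h <= a * h / 32.
      have -> : a * h / 32 = 1 / 32 * (a * h) by field.
      by rewrite /eps -mulrA ler_pM2r // mulr_gt0.
    have := mulr_gt0 a0 h0; lra.
  - by rewrite divr_gt0.
  - by rewrite ler_pdivrMr // mul1r.
  - by rewrite divfK // gt_eqF.
pose D := Omega `&` [set x : 'rV[R]_m.+1 | xlast x < h].
pose Kc := closure Omega `&` [set x : 'rV[R]_m.+1 | xlast x <= h].
have KcD x : Kc x -> ~ D x -> w x <= v x.
  move=> [cx xh] nD; have [Ox|nOx] := pselect (Omega x); last first.
    by apply: w_bd => //; apply/boundaryE.
  apply: w_top => //; apply/eqP; rewrite eq_le xh /= leNgt; apply/negP => xlt.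
  exact: nD.
have dE x : dotv (g + eps *: e_last R m) x = dotv g x + eps * xlast x.
  by rewrite dotvDl dotvZl dotv_e_last.
have w_D x : D x -> w x <= v x.
  move=> Dx.
  have := @comparison_cylindric R m Omega D Kc u Lam (u 0) (kappa^-1 / kappa) b A
    (g + eps *: e_last R m) oO cO cu uc MA _ _ _ _ _ _ b0 A0 _ _ x Dx.
  rewrite /= dE vE /w => H; suff : u 0 + (dotv g x + eps * xlast x) +
      b * dotv (xprime x) (xprime x) + A * xlast x ^+ 2 <= u x by lra.
  apply: H.
  - apply: openI => //.
    by apply: (@open_comp _ _ (@xlast R m) [set r | r < h]);
      [move=> y _; exact: continuous_xlast|exact: open_lt].
  - by move=> y [].
  - apply: closedI; first exact: closed_closure.
    by apply: (@preimage_closed _ _ (@xlast R m) [set r | r <= h]);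
      [move=> y _; exact: continuous_xlast|exact: closed_le].
  - by move=> y [cy _]; exact: (dotv_closure_le m_gt0 oO posO kappa_gt0 kO).
  - by move=> y [Oy /= yh]; split; [exact: subset_closure|exact: ltW].
  - by move=> y [].
  - have -> : 2 * b = a * kappa / 4 by rewrite /b; field.
    have -> : (a * kappa / 4) ^+ m * (2 * A) = (a * kappa / 4) ^+ m * (2 * (c * a)) / h.
      by rewrite /A; ring.
    by rewrite ltr_pdivlMr.
  - by move=> y Ky nDy; have := KcD _ Ky nDy; rewrite vE /w dE; lra.
(* A point violating eps x_n <= v can be shrunk towards 0 into the slab, where the violation
   survives because v is convex and v(0) = 0. *)
have [x cx vx] := v_lt eps0.
have x0 : 0 < xlast x.
  by rewrite -(pmulr_rgt0 _ eps0); exact: le_lt_trans (v_ge0 cx) vx.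
pose s := Num.min 1 (h / (2 * xlast x)).
have s0 : 0 < s by rewrite lt_min ltr01 divr_gt0 // mulr_gt0.
have s1 : s <= 1 by rewrite ge_min lexx.
have sx : s * xlast x < h.
  have : s <= h / (2 * xlast x) by rewrite ge_min lexx orbT.
  rewrite ler_pdivlMr ?mulr_gt0 // => H; lra.
have csx : closure Omega (s *: x).
  have := cvx_set_closure cO bd0.1 cx (t := s).
  by rewrite (ltW s0) s1 scaler0 add0r; apply.
have Ksx : Kc (s *: x) by split => //=; rewrite xlastZ ltW.
have : w (s *: x) <= v (s *: x).
  by have [/w_D|] := pselect (D (s *: x)); last exact: KcD.
rewrite leNgt => /negP; apply; apply: le_lt_trans (ray_le (ltW s0) s1 cx) _.
apply: (@lt_le_trans _ _ (eps * xlast (s *: x))).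
  by rewrite xlastZ mulrCA ltr_pM2l.
by rewrite /w -addrA lerDl addr_ge0 // mulr_ge0 ?sqr_ge0 ?dotv_ge0 // ltW.
Qed.

(** For a = v(t e_n) / t the failure of the estimate implies t <= cs a^beta, which is the hypothesis
    of the threshold. *)
Lemma axis_growth_le (beta cs t : R) : 0 < beta -> 0 < cs ->
  growth_threshold m kappa M N Lam tau theta beta cs -> 0 < t -> t < tau ->
  v (mkpt 0 t) <= cs `^ (- beta^-1) * t `^ (1 + beta^-1).
Proof.
move=> beta0 cs0 gt t0 tt; set de := beta^-1.
have de0 : 0 < de by rewrite invr_gt0.
rewrite leNgt; apply/negP => lt_v; pose a := v (mkpt 0 t) / t.
have C0 : 0 < cs `^ (- de) * t `^ (1 + de) by rewrite mulr_gt0 // powR_gt0.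
have a0 : 0 < a by rewrite divr_gt0 // (lt_trans C0).
have aB : a <= boundary_slope kappa N by rewrite ler_pdivrMr //; exact: axis_linear_le.
have at_le : a * t <= v (mkpt 0 t) by rewrite divfK // gt_eqF.
have at_beta : t <= cs * a `^ beta.
  have h1 : cs `^ (- de) * t `^ de <= a.
    rewrite ler_pdivlMr // -mulrA; apply: le_trans (ltW lt_v).
    rewrite addrC powRD; last by rewrite (gt_eqF t0) implybT.
    by rewrite powRr1 // ltW.
  have h2 : (cs `^ (- de) * t `^ de) `^ beta <= a `^ beta.
    apply: ge0_ler_powR => //; [exact: ltW| |by rewrite nnegrE ltW].
    by rewrite nnegrE mulr_ge0 ?powR_ge0.
  have -> : t = cs * (cs `^ (- de) * t `^ de) `^ beta.
    rewrite powRM ?powR_ge0 // -!powRrM mulNr mulVf ?gt_eqF // powRr1 ?(ltW t0) //.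
    by rewrite powRN powRr1 ?(ltW cs0) // mulrA divff ?gt_eqF // mul1r.
  by rewrite ler_pM2l.
have [] := gt a t a0 aB t0 at_beta; set h := slab_height kappa M N a t => ht c2 c3.
have B0 := boundary_slope_gt0; have a20 : 0 < a ^+ 2 by rewrite exprn_gt0.
set B := boundary_slope kappa N in aB B0.
have hE : h * (kappa * a ^+ 2) = 4 * M * B ^+ 2 * t.
  by rewrite /h /slab_height -/B; field; rewrite !gt_eqF.
have ka : 0 < kappa * a ^+ 2 by rewrite mulr_gt0.
have aB2 : a ^+ 2 <= B ^+ 2 by rewrite lerXn2r // nnegrE ltW.
have th : t <= h.
  rewrite -(ler_pM2r ka) hE.
  have h1 : kappa * a ^+ 2 <= 1 * B ^+ 2 by apply: ler_pM => //; exact: ltW.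
  have h2 : 1 * B ^+ 2 <= M * B ^+ 2 by rewrite ler_pM2r // exprn_gt0.
  have h3 : t * (kappa * a ^+ 2) <= t * (M * B ^+ 2).
    by rewrite ler_pM2l //; exact: le_trans h1 h2.
  have : 0 <= t * (M * B ^+ 2).
    by apply: mulr_ge0; [exact: ltW|apply: mulr_ge0; [exact: ltW|exact: sqr_ge0]].
  lra.
have h0 : 0 < h := lt_le_trans t0 th.
apply: (no_linear_growth a0 t0 th ht at_le _ c2 c3).
rewrite -/B -(ler_pM2r h0).
have -> : 4 * M * (t / h) * B ^+ 2 * h = 4 * M * B ^+ 2 * t.
  by field; rewrite gt_eqF.
by rewrite -hE mulrC.
Qed.

(** The three constants belong to x_n >= tau, to the axis end and to the boundary end of the segment
    through x. With the boundary end over r x', its share is B s / r, and s <= M r^2 |x'|^2 gives (s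
    / r)^2 <= M s |x'|^2 <= M |x|^3. This is the exponent 3/2, whence delta <= 1/2. *)
Lemma growth_le (delta Cax V : R) : 0 < delta -> delta <= 1 / 2 -> 0 <= Cax -> 0 <= V ->
  (forall x, closure Omega x -> v x <= V) ->
  (forall t, 0 < t -> t < tau -> v (mkpt 0 t) <= Cax * t `^ (1 + delta)) ->
  forall x, closure Omega x ->
  v x <= (V / tau `^ (1 + delta) + Cax + boundary_slope kappa N * M) * enorm x `^ (1 + delta).
Proof.
move=> d0 d2 C0 V0 vV vax x cx; set B := boundary_slope kappa N.
have B0 : 0 < B := boundary_slope_gt0.
have bv y : boundary Omega y -> xlast y < tau -> v y <= B * xlast y.
  exact: boundary_growth.
clearbody B; set s := xlast x; have s0 : 0 <= s := xlast_ge0 cx.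
set X := enorm x `^ (1 + delta); have X0 : 0 <= X := powR_ge0 _ _.
have V10 : 0 <= V / tau `^ (1 + delta) by rewrite divr_ge0 ?powR_ge0.
have BM0 : 0 <= B * M by rewrite mulr_ge0 // ltW.
have d10 : 0 <= 1 + delta by rewrite addr_ge0 // ltW.
have sx : s <= enorm x.
  rewrite -(ler_pXn2r (n := 2)) ?nnegrE ?enorm_ge0 //.
  by rewrite enormE dotv_xprime lerDr dotv_ge0.
have sX r : 0 <= r -> r <= s -> r `^ (1 + delta) <= X.
  move=> r0 rs; apply: ge0_ler_powR; rewrite ?nnegrE ?enorm_ge0 //.
  exact: le_trans rs sx.
rewrite !mulrDl.
have [st|ts] := ltP s tau; last first.
  have h1 : tau `^ (1 + delta) <= X by apply: sX => //; exact: ltW.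
  have h2 : V <= V / tau `^ (1 + delta) * X.
    by rewrite mulrAC ler_pdivlMr ?powR_gt0 // ler_wpM2l.
  have := vV _ cx; have := mulr_ge0 C0 X0; have := mulr_ge0 BM0 X0; lra.
move: s0; rewrite le_eqVlt => /orP[/eqP s_eq0|s0].
  have x_eq0 : x = 0.
    apply/eqP; rewrite -dotv_eq0 eq_le dotv_ge0 andbT.
    have := xlast_ge_dotv m_gt0 oO posO kappa_gt0 kO cx; rewrite -/s -s_eq0.
    by rewrite pmulr_rle0.
  by rewrite x_eq0 v00 -!mulrDl mulr_ge0 ?powR_ge0 // !addr_ge0.
have ax : v (mkpt 0 s) <= Cax * X.
  by apply: le_trans (vax _ s0 st) _; rewrite ler_wpM2l // sX // ltW.
have [e0|e0] := eqVneq (xprime x) 0.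
  have -> : v x = v (mkpt 0 s) by rewrite -{1}(mkptK x) e0.
  have := mulr_ge0 V10 X0; have := mulr_ge0 BM0 X0; lra.
set e := xprime x in e0.
have xE : x = mkpt e s by rewrite mkptK.
have [r r1 br] : exists2 r, 1 <= r & boundary Omega (mkpt (r *: e) s).
  have [Ox|nOx] := pselect (Omega x); last first.
    exists 1; first exact: lexx.
    by rewrite scale1r -xE; apply/boundaryE.
  rewrite xE in Ox; have [t t0 bt] := exit_horizontal oO posO kappa_gt0 kO Ox e0.
  by exists (1 + t); [rewrite lerDl ltW|rewrite scalerDl scale1r].
have r0 : 0 < r := lt_le_trans ltr01 r1.
have H : (r - 1 + 1) * v x <= (r - 1) * v (mkpt 0 s) + 1 * v (mkpt (r *: e) s).
  apply: (cvx_fun_weighted cv (subset_closure (axis_in s0 st)) br.1).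
  - by rewrite subr_ge0.
  - by [].
  - by rewrite subrK.
  - by rewrite {1}xE !mkptZ mkptD scaler0 add0r scale1r -mulrDl subrK.
rewrite subrK mul1r in H.
have := bv _ br; rewrite xlast_mkpt => /(_ st) vr.
have := xlast_boundary_le br; rewrite xlast_mkpt xprime_mkpt !(dotvZl, dotvZr) => /(_ st) sM.
suff H2 : s / r <= M * X.
  have h1 : (r - 1) * v (mkpt 0 s) <= r * (Cax * X).
    have h2 : 0 <= v (mkpt 0 s) by apply: v_ge0; exact/subset_closure/axis_in.
    have h3 := ler_wpM2l (ltW r0) ax; lra.
  have h2 : B * s <= r * (B * (M * X)).
    rewrite mulrCA ler_pM2l // mulrC -ler_pdivrMr //.
  have h4 : r * v x <= r * (Cax * X + B * (M * X)).
    rewrite mulrDr; apply: le_trans H _; apply: lerD => //.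
    exact: le_trans vr h2.
  rewrite ler_pM2l // in h4.
  by have := mulr_ge0 V10 X0; lra.
have MX0 : 0 <= M * X by rewrite mulr_ge0 // ltW.
rewrite -(ler_pXn2r (n := 2)) ?nnegrE ?divr_ge0 ?(ltW s0) ?(ltW r0) //.
have xx1 : enorm x <= 1.
  rewrite -(ler_pXn2r (n := 2)) ?nnegrE ?enorm_ge0 // expr1n enormE.
  have := xlast_ge_dotv m_gt0 oO posO kappa_gt0 kO cx; rewrite -/s => H3.
  have : kappa * dotv x x <= kappa * 1.
    by rewrite mulr1; apply: le_trans H3 _; exact: le_trans (ltW st) tau_le.
  by rewrite ler_pM2l.
have x0 : 0 < enorm x by rewrite sqrtr_gt0 dotv_xprime ltr_pwDr ?dotv_ge0 ?exprn_gt0.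
have h1 : (s / r) ^+ 2 <= M * (s * dotv e e).
  rewrite exprMn exprVn ler_pdivrMr ?exprn_gt0 //.
  have := ler_wpM2l (ltW s0) sM; rewrite !expr2; lra.
have h2 : s * dotv e e <= enorm x ^+ 3.
  rewrite exprS; apply: ler_pM => //; rewrite ?(ltW s0) ?dotv_ge0 //.
  by rewrite enormE dotv_xprime lerDl sqr_ge0.
have h3 : enorm x ^+ 3 <= X ^+ 2.
  rewrite -powR_mulrn ?enorm_ge0 // /X -powR_mulrn ?powR_ge0 // -powRrM.
  apply: ger_powR; first by rewrite x0.
  lra.
apply: (le_trans h1); rewrite exprMn.
have h4 : M * (s * dotv e e) <= M * X ^+ 2 by rewrite ler_pM2l //; exact: le_trans h3.
apply: (le_trans h4); apply: ler_wpM2r; first exact: sqr_ge0.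
by rewrite expr2 ler_pMr.
Qed.

End axis_growth.

(** * Dimension one *)

Section dimension_one.
Context (R : realType) (Omega : set 'rV[R]_1) (u : 'rV[R]_1 -> R) (Lam : R).
Hypotheses (oO : open Omega) (cO : cvx_set Omega)
  (posO : forall x, Omega x -> 0 < @xlast R 0 x) (bd0 : boundary Omega 0)
  (Lam_ge0 : 0 <= Lam) (cu : cvx_fun (closure Omega) u)
  (uc : {within closure Omega, continuous u}) (MA : monge_ampere_le Omega u Lam).

Local Notation xl := (@xlast R 0).

Local Lemma point_eq (x y : 'rV[R]_1) : xl x = xl y -> x = y.
Proof. by rewrite -{2}(mkptK x) -{2}(mkptK y) !thinmx0 => ->. Qed.

Local Lemma xl_ge0 x : closure Omega x -> 0 <= xl x.
Proof.
move: x; apply: (@closure_sub_closed _ _ _ [set x : 'rV[R]_1 | 0 <= xl x]).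
  by apply: (@preimage_closed _ _ xl [set r | 0 <= r]);
    [move=> y _; exact: continuous_xlast|exact: closed_ge].
by move=> x /posO/ltW.
Qed.

Lemma interval_sub x y : closure Omega x -> 0 < xl y -> xl y < xl x -> Omega y.
Proof.
move=> cx y0 yx; have [z [Oz _]] := bd0.1 setT filterT.
have z0 := posO Oz; have [yz|zy] := leP (xl y) (xl z).
  have -> : y = (1 - xl y / xl z) *: 0 + (xl y / xl z) *: z.
    by apply: point_eq; rewrite scaler0 add0r xlastZ divfK // gt_eqF.
  apply: cvx_closure_interior => //; [exact: bd0.1|exact: divr_gt0|].
  by rewrite ler_pdivrMr // mul1r.
have xz : 0 < xl x - xl z by rewrite subr_gt0 (lt_trans zy).
have -> : y = (1 - (xl x - xl y) / (xl x - xl z)) *: x +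
    ((xl x - xl y) / (xl x - xl z)) *: z.
  by apply: point_eq; rewrite xlastD !xlastZ; field; rewrite gt_eqF.
apply: cvx_closure_interior => //; first by rewrite divr_gt0 // subr_gt0.
by rewrite ler_pdivrMr // mul1r lerD2l lerN2 ltW.
Qed.

(** Comparison on the interval below x puts the parabola of slope l at 0 under u; convexity of u
    along rays from 0 extends the linear bound beyond x. *)
Lemma supporting_of_chord (l A : R) x : closure Omega x -> 0 < xl x ->
  0 < A -> Lam < 2 * A -> u 0 + l * xl x + A * xl x ^+ 2 <= u x ->
  supporting Omega u 0 (mkpt 0 l).
Proof.
move=> cx x0 A0 LA wx; set h := xl x in x0 wx *.
have dE (y : 'rV[R]_1) : dotv (mkpt 0 l) y = l * xl y.
  by rewrite -{1}(mkptK y) dotv_mkpt dotv0l add0r.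
have n0 (y : 'rV[R]_1) : dotv (xprime y) (xprime y) = 0 by rewrite /dotv big_ord0.
(* The x' part is an empty sum and enters the Hessian determinant as a zeroth power, leaving 2A. *)
pose w (y : 'rV[R]_1) := u 0 + dotv (mkpt 0 l) y + 1 * dotv (xprime y) (xprime y)
  + A * xl y ^+ 2.
pose D := Omega `&` [set y : 'rV[R]_1 | xl y < h].
pose Kc := closure Omega `&` [set y : 'rV[R]_1 | xl y <= h].
have w_D y : D y -> w y <= u y.
  apply: (@comparison_cylindric R 0 Omega D Kc u Lam (u 0) (h ^+ 2) 1 A) => //.
  - by move=> y1 y2 t O1 O2; apply: cu; exact: subset_closure.
  - apply: openI => //.
    by apply: (@open_comp _ _ xl [set r | r < h]);
      [move=> z _; exact: continuous_xlast|exact: open_lt].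
  - by move=> z [].
  - apply: closedI; first exact: closed_closure.
    by apply: (@preimage_closed _ _ xl [set r | r <= h]);
      [move=> z _; exact: continuous_xlast|exact: closed_le].
  - move=> z [cz /= zh]; rewrite dotv_xprime n0 add0r lerXn2r // ?nnegrE ?(ltW x0) //.
    exact: xl_ge0.
  - by move=> z [Oz /= zh]; split; [exact: subset_closure|exact: ltW].
  - by move=> z [].
  - by rewrite expr0 mul1r.
  move=> z [cz /= zh] nDz; rewrite dE n0 mulr0 addr0.
  have := xl_ge0 cz; rewrite le_eqVlt => /orP[/eqP z0|z0].
    have -> : z = 0 by apply: point_eq; rewrite -z0 /xlast mxE.
    by rewrite /xlast mxE expr0n !mulr0 !addr0.
  move: zh; rewrite le_eqVlt => /orP[/eqP zh|zh].
    by have -> : z = x by exact: point_eq.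
  by exfalso; apply: nDz; split => //; exact: (interval_sub cx).
move=> y cy; rewrite subr0 dE.
have := xl_ge0 cy; rewrite le_eqVlt => /orP[/eqP y0|y0].
  have -> : y = 0 by apply: point_eq; rewrite -y0 /xlast mxE.
  by rewrite /xlast mxE mulr0 addr0.
pose s := Num.min 1 (h / (2 * xl y)).
have s0 : 0 < s by rewrite lt_min ltr01 divr_gt0 // mulr_gt0.
have s1 : s <= 1 by rewrite ge_min lexx.
have sy : s * xl y < h.
  have : s <= h / (2 * xl y) by rewrite ge_min lexx orbT.
  rewrite ler_pdivlMr ?mulr_gt0 // => H; lra.
have Ds : D (s *: y).
  split; last by rewrite /= xlastZ.
  by apply: (interval_sub cx); rewrite xlastZ // mulr_gt0.
have := w_D _ Ds; rewrite /w dE n0 mulr0 addr0 xlastZ => H1.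
have := cu bd0.1 cy (t := s); rewrite s1 ltW // scaler0 add0r => /(_ isT) H2.
have H3 : 0 <= A * (s * xl y) ^+ 2 by rewrite mulr_ge0 ?sqr_ge0 // ltW.
have : s * (u 0 + l * xl y) <= s * u y by lra.
by rewrite ler_pM2l.
Qed.

(** If the quadratic bound fails at x, the excess divided by x_n is an admissible increase of the
    slope, against maximality. *)
Lemma dimension_one :
  (exists g, boundary_gradient Omega u 0 (e_last R 0) g) /\
  forall g, boundary_gradient Omega u 0 (e_last R 0) g ->
  forall x, closure Omega x ->
    u x - u 0 - dotv g x <= (Lam + 1) * enorm x `^ (1 + 1).
Proof.
have A0 : 0 < Lam + 1 by rewrite ltr_wpDl.
have LA : Lam < 2 * (Lam + 1) by have := Lam_ge0; lra.
split.
  have [z [Oz _]] := bd0.1 setT filterT; have z0 := posO Oz.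
  have cz := subset_closure Oz.
  pose l := (u z - u 0 - (Lam + 1) * xl z ^+ 2) / xl z.
  apply: (boundary_gradient_exists xl_ge0 cz z0 (b := 0) (t0 := l)).
  apply: (supporting_of_chord cz z0 A0 LA).
  by rewrite /l divfK ?gt_eqF //; lra.
move=> g [sg mg] x cx; have e2 : enorm x `^ (1 + 1) = xl x ^+ 2.
  rewrite (_ : 1 + 1 = 2%:R) // powR_mulrn ?enorm_ge0 // enormE dotv_xprime.
  by rewrite /dotv big_ord0 add0r.
have gE y : dotv g y = xl g * xl y.
  by rewrite -{1}(mkptK g) -{1}(mkptK y) dotv_mkpt /dotv big_ord0 add0r.
rewrite e2 gE; have := xl_ge0 cx; rewrite le_eqVlt => /orP[/eqP x0|x0].
  have -> : x = 0 by apply: point_eq; rewrite -x0 /xlast mxE.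
  by rewrite /xlast [(0 : 'rV_1) _ _]mxE expr0n !mulr0 !subr0 subrr.
rewrite leNgt; apply/negP => H.
pose eps := (u x - u 0 - xl g * xl x - (Lam + 1) * xl x ^+ 2) / xl x.
have eps0 : 0 < eps by rewrite divr_gt0 // subr_gt0.
apply: (mg _ eps0).
have -> : g + eps *: e_last R 0 = mkpt 0 (xl g + eps).
  by apply: point_eq; rewrite xlastD xlastZ e_lastE !xlast_mkpt mulr1.
apply: (supporting_of_chord cx x0 A0 LA).
have : eps * xl x = u x - u 0 - xl g * xl x - (Lam + 1) * xl x ^+ 2.
  by rewrite divfK // gt_eqF.
lra.
Qed.

End dimension_one.

(** * Assembling the estimate *)

Lemma alexandrov_monge_ampere_le (R : realType) (m : nat) (Omega : set 'rV[R]_m.+1)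
    (u f : 'rV[R]_m.+1 -> R) (Lam : R) : 0 <= Lam ->
  alexandrov_solution Omega u f -> (forall x, Omega x -> 0 <= f x <= Lam) ->
  monge_ampere_le Omega u Lam.
Proof.
move=> L0 [_ uf] fL E oE EO; rewrite uf //; last exact: sub_sigma_algebra.
by apply: integral_le_lebesgue_outer => // x /EO/fL.
Qed.

Lemma enorm_powR (R : realType) (n : nat) (y : 'rV[R]_n) (alpha : R) : 0 < alpha ->
  enorm y `^ (2 + alpha) = dotv y y * dotv y y `^ (alpha / 2).
Proof.
move=> a0; have [->|y0] := eqVneq y 0.
  by rewrite /enorm !dotv0l sqrtr0 mul0r powR0 // gt_eqF // addr_gt0.
have e0 : 0 < enorm y by rewrite sqrtr_gt0 dotv_gt0.
rewrite -enormE powRD; last by rewrite (gt_eqF e0) implybT.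
rewrite -powR_mulrn ?(ltW e0) // -powRrM.
by rewrite [_ * (alpha / _)]mulrC divfK // pnatr_eq0.
Qed.

(** * Constants and conclusion in dimension at least two *)

Section higher_dimension.
Context (R : realType) (m : nat) (kappa tau M K Lam theta beta cs : R).
Hypotheses (m_gt0 : (0 < m)%N) (kappa_gt0 : 0 < kappa) (kappa_le1 : kappa <= 1)
  (tau_gt0 : 0 < tau) (tau_le : tau <= kappa) (M_ge1 : 1 <= M) (Lam_ge0 : 0 <= Lam)
  (theta_gt0 : 0 < theta) (beta_ge2 : 2 <= beta) (cs_gt0 : 0 < cs).

(** Bounds both F = P - g_n Q and the error left after tilting by g_n. *)
Definition tilted_bound : R := 2 * M * (1 + `|slope_bound kappa (2 * M) tau Lam K|).

Definition sup_bound : R := 2 * K + (M + kappa^-1 / kappa) / 2 +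
  `|slope_bound kappa (2 * M) tau Lam K| * kappa^-1.

Definition growth_constant : R := sup_bound / tau `^ (1 + beta^-1) +
  cs `^ (- beta^-1) + boundary_slope kappa tilted_bound * (2 * M).

Lemma sup_bound_ge0 : 0 <= K -> 0 <= sup_bound.
Proof.
move=> K0; have ki : 0 <= kappa^-1 by rewrite invr_ge0 ltW.
have M0 : 0 <= M := le_trans ler01 M_ge1.
by rewrite /sup_bound !addr_ge0 ?mulr_ge0 ?addr_ge0 ?mulr_ge0.
Qed.

Lemma growth_constant_gt0 : 0 <= K -> 0 < growth_constant.
Proof.
move=> K0; have M0 : 0 < M := lt_le_trans ltr01 M_ge1.
have N0 : 0 <= tilted_bound.
  by rewrite /tilted_bound !mulr_ge0 ?addr_ge0 // ltW.
rewrite /growth_constant -addrA ltr_wpDl ?divr_ge0 ?powR_ge0 ?sup_bound_ge0 //.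
by rewrite ltr_wpDr ?powR_gt0 // mulr_ge0 ?divr_ge0 ?mulr_ge0 // ltW.
Qed.

Lemma pointwise_estimate (Omega : set 'rV[R]_m.+1) (u : 'rV[R]_m.+1 -> R)
    (bq bp : 'rV[R]_m) (Q P : 'rV[R]_m -> R) :
  growth_threshold m kappa (2 * M) tilted_bound Lam tau theta beta cs ->
  open Omega -> cvx_set Omega -> (forall x, Omega x -> 0 < xlast x) ->
  boundary Omega 0 -> (forall x, boundary Omega x -> kappa * dotv x x <= xlast x) ->
  cvx_fun (closure Omega) u -> {within closure Omega, continuous u} ->
  monge_ampere_le Omega u Lam -> (forall x, boundary Omega x -> `|u x| <= K) ->
  (forall t y, Q (t *: y) = t ^+ 2 * Q y) -> (forall t y, P (t *: y) = t ^+ 2 * P y) ->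
  (forall y, `|Q y| <= M * dotv y y) -> (forall y, `|P y| <= M * dotv y y) ->
  dotv bp bp <= M ->
  (forall x, boundary Omega x -> xlast x < tau ->
    `|xlast x - (dotv bq (xprime x) + Q (xprime x))| <=
    M * (dotv (xprime x) (xprime x) * dotv (xprime x) (xprime x) `^ theta)) ->
  (forall x, boundary Omega x -> xlast x < tau ->
    `|u x - (u 0 + dotv bp (xprime x) + P (xprime x))| <=
    M * (dotv (xprime x) (xprime x) * dotv (xprime x) (xprime x) `^ theta)) ->
  (exists g, boundary_gradient Omega u 0 (e_last R m) g) /\
  forall g, boundary_gradient Omega u 0 (e_last R m) g ->
  forall x, closure Omega x ->
    u x - u 0 - dotv g x <= growth_constant * enorm x `^ (1 + beta^-1).
Proof.
move=> gt oO cO posO bd0 kO cu uc MA uK QZ PZ QM PM bpM Hq Hp.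
have M0 : 0 < M := lt_le_trans ltr01 M_ge1.
have M20 : 0 < 2 * M by rewrite mulr_gt0.
have M21 : 1 <= 2 * M by have := M_ge1; lra.
have K0 : 0 <= K := le_trans (normr_ge0 _) (uK _ bd0).
have small x : boundary Omega x -> xlast x < tau ->
    M * (dotv (xprime x) (xprime x) * dotv (xprime x) (xprime x) `^ theta) <=
    M * dotv (xprime x) (xprime x).
  move=> bx xt; rewrite ler_pM2l // ler_piMr ?dotv_ge0 //.
  have d1 : dotv (xprime x) (xprime x) <= 1.
    apply: le_trans (dotv_xprime_le m_gt0 oO posO kappa_gt0 kO bx.1) _.
    by rewrite ler_pdivrMr // mul1r (le_trans (ltW xt)).
  have : dotv (xprime x) (xprime x) `^ theta <= 1 `^ theta.
    by apply: ge0_ler_powR; rewrite ?nnegrE ?dotv_ge0 // ltW.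
  by rewrite powR1.
(* The quadratic part and, as |x'| <= 1, the error contribute M |x'|^2 each; hence 2 M in place of
   M. *)
have Hq1 x : boundary Omega x -> xlast x < tau ->
    `|xlast x - dotv bq (xprime x)| <= 2 * M * dotv (xprime x) (xprime x).
  move=> bx xt; have := Hq _ bx xt; have := small _ bx xt; have := QM (xprime x).
  rewrite !ler_norml => /andP[q1 q2] h /andP[h1 h2]; apply/andP; split; lra.
have Hp1 x : boundary Omega x -> xlast x < tau ->
    `|u x - (u 0 + dotv bp (xprime x))| <= 2 * M * dotv (xprime x) (xprime x).
  move=> bx xt; have := Hp _ bx xt; have := small _ bx xt; have := PM (xprime x).
  rewrite !ler_norml => /andP[q1 q2] h /andP[h1 h2]; apply/andP; split; lra.
have bpM1 : dotv bp bp <= 2 * M by lra.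
split.
  exact: (boundary_gradient_ex m_gt0 oO cO posO bd0 kappa_gt0 kO M20 tau_gt0 Hq1
    Lam_ge0 cu uc MA uK Hp1 bpM1).
move=> g gg.
have [gp gB] := boundary_gradient_bound m_gt0 oO cO posO bd0 kappa_gt0 kO M20 tau_gt0 Hq1
    Lam_ge0 cu uc MA uK Hp1 bpM1 gg.
have bq0 := boundary_tangent m_gt0 oO cO posO bd0 kappa_gt0 kO M20 tau_gt0 Hq1.
set B := slope_bound kappa (2 * M) tau Lam K in gB.
have {}gB : `|xlast g| <= `|B| := le_trans gB (ler_norm _).
have gE x : dotv g x = dotv bp (xprime x) + xlast g * xlast x.
  by rewrite -{1}(mkptK g) -{1}(mkptK x) dotv_mkpt gp.
pose v x := u x - u 0 - dotv g x.
pose F y := P y - xlast g * Q y.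
pose N := tilted_bound; have NE : N = 2 * M * (1 + `|B|) by [].
have B0 : 0 <= `|B| := normr_ge0 B.
have MB : 0 <= M * `|B| by rewrite mulr_ge0 // ltW.
have N1 : 1 <= N by rewrite NE; have := M_ge1; lra.
have N0 : 0 < N := lt_le_trans ltr01 N1.
have cv : cvx_fun (closure Omega) v.
  move=> x y t cx cy t01; have := cu _ _ _ cx cy t01.
  by rewrite /v dotvDr !dotvZr; lra.
have v00 : v 0 = 0 by rewrite /v dotv0r subr0 subrr.
have v_ge0 x : closure Omega x -> 0 <= v x.
  by move=> cx; have := gg.1 x cx; rewrite subr0 /v; lra.
have FZ t y : F (t *: y) = t ^+ 2 * F y by rewrite /F PZ QZ; ring.
have gQ y : `|xlast g * Q y| <= `|B| * (M * dotv y y).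
  by rewrite normrM ler_pM.
have FN y : F y <= N * dotv y y.
  have := PM y; have := gQ y; rewrite !ler_norml => /andP[h1 _] /andP[_ h2].
  have := dotv_ge0 y => d0; have := mulr_ge0 (ltW M0) d0 => Md.
  have := mulr_ge0 B0 Md; rewrite /F NE; lra.
have vF x : boundary Omega x -> xlast x < tau ->
    `|v x - F (xprime x)| <=
    N * (dotv (xprime x) (xprime x) * dotv (xprime x) (xprime x) `^ theta).
  move=> bx xt; have hp := Hp _ bx xt; have hq := Hq _ bx xt.
  rewrite bq0 dotv0l add0r in hq.
  set E := _ * _ `^ _ in hp hq *.
  have E0 : 0 <= E by rewrite mulr_ge0 ?dotv_ge0 ?powR_ge0.
  have -> : v x - F (xprime x) = (u x - (u 0 + dotv bp (xprime x) + P (xprime x))) -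
      xlast g * (xlast x - Q (xprime x)).
    by rewrite /v /F gE; ring.
  apply: le_trans (ler_normB _ _) _.
  have h1 : `|xlast g * (xlast x - Q (xprime x))| <= `|B| * (M * E).
    by rewrite normrM ler_pM.
  have ME : 0 <= M * E by rewrite mulr_ge0 // ltW.
  have BME := mulr_ge0 B0 ME.
  rewrite NE; lra.
have v_lt (eps : R) : 0 < eps -> exists2 x, closure Omega x & v x < eps * xlast x.
  move=> eps0; apply: contrapT => H; apply: (gg.2 eps eps0) => x cx.
  rewrite subr0 dotvDl dotvZl dotv_e_last.
  rewrite leNgt; apply/negP => h; apply: H; exists x => //; rewrite /v; lra.
have V0 := sup_bound_ge0 K0.
have vV x : closure Omega x -> v x <= sup_bound.
  move=> cx; have := cvx_fun_le_boundary m_gt0 oO posO kappa_gt0 kO cu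
    (fun y by_ => le_trans (ler_norm _) (uK y by_)) cx.
  have := uK _ bd0; rewrite ler_norml => /andP[h1 _] h2.
  have := @normr_dotv_le R m bp (xprime x); rewrite ler_norml => /andP[h3 _].
  have x0 := xlast_closure_ge0 m_gt0 oO posO kappa_gt0 kO cx.
  have xk := xlast_le m_gt0 oO posO kappa_gt0 kO cx.
  have h4 := dotv_xprime_le m_gt0 oO posO kappa_gt0 kO cx.
  have h5 : xlast x / kappa <= kappa^-1 / kappa by rewrite ler_pM2r // invr_gt0.
  have h6 : `|xlast g * xlast x| <= `|B| * kappa^-1.
    by rewrite normrM ler_pM // ger0_norm.
  move: h6; rewrite ler_norml => /andP[h6 _].
  by rewrite /v gE /sup_bound -/B; lra.
have beta0 : 0 < beta by apply: lt_le_trans beta_ge2.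
have de0 : 0 < beta^-1 by rewrite invr_gt0.
have de2 : beta^-1 <= 1 / 2 by rewrite div1r lef_pV2 ?posrE.
have cuO : cvx_fun Omega u.
  by move=> x y t Ox Oy; apply: cu; exact: subset_closure.
have ax := axis_growth_le m_gt0 oO cO posO bd0 kappa_gt0 kappa_le1 kO M21 tau_gt0 tau_le
  Hq1 cv v00 v_ge0 N1 theta_gt0 FZ FN vF cuO uc MA (fun=> erefl) v_lt beta0 cs_gt0 gt.
exact: (growth_le m_gt0 oO cO posO bd0 kappa_gt0 kO M21 tau_gt0 tau_le Hq1 cv v00
  v_ge0 N1 theta_gt0 FN vF de0 de2 (powR_ge0 _ _) V0 vV ax).
Qed.

End higher_dimension.

(* The dimension is n = m.+1; rho is the size of the neighbourhood of 0 on
   which the boundary is pinched, and K bounds |phi| on the boundary. *)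
Theorem theorem2p1 (R : realType) (m : nat) (alpha : R)
    (alpha_gt0 : 0 < alpha) (alpha_lt1 : alpha < 1) :
  exists2 delta0 : R, 0 < delta0 &
  forall (lambda Lambda M kappa K rho : R),
    0 < lambda -> lambda <= Lambda -> 0 < kappa -> 0 < rho ->
  exists2 C : R, 0 < C &
  forall (Omega : set 'rV[R]_m.+1) (u f phi : 'rV[R]_m.+1 -> R)
      (p q : mpoly m R),
    open Omega ->
    convex_set (Omega : set (convex_lmodType 'rV[R]_m.+1)) ->
    (forall x, Omega x -> 0 < xlast x) ->
    boundary Omega 0 ->
    convex_function (closure Omega : set (convex_lmodType 'rV[R]_m.+1)) u ->
    {within closure Omega, continuous u} ->
    alexandrov_solution Omega u f ->
    (forall x, Omega x -> lambda <= f x <= Lambda) ->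
    (forall x, boundary Omega x -> u x = phi x) ->
    uniformly_convex_at0 kappa Omega ->
    (forall x, boundary Omega x -> `|phi x| <= K) ->
    quadratic p ->
    quadratic q ->
    (forall x, boundary Omega x -> enorm x < rho ->
       `|xlast x - peval q (xprime x)| <= M * enorm (xprime x) `^ (2 + alpha)) ->
    (forall x, boundary Omega x -> enorm x < rho ->
       `|phi x - peval p (xprime x)| <= M * enorm (xprime x) `^ (2 + alpha)) ->
    Num.max (enorm (pgrad p 0))
      (Num.max (opnorm (phess p 0)) (opnorm (phess q 0))) <= M ->
    (exists g, boundary_gradient Omega u 0 (e_last R m) g) /\
    forall g, boundary_gradient Omega u 0 (e_last R m) g ->
    forall x, closure Omega x ->
      u x - u 0 - dotv g x <= C * enorm x `^ (1 + delta0).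
Proof.
have th0 : 0 < alpha / 2 by rewrite divr_gt0.
case: m => [|n].
  exists 1 => // lambda Lam M kappa K rho l0 lL _ _.
  have L0 : 0 <= Lam := le_trans (ltW l0) lL.
  exists (Lam + 1) => [|Omega u f phi p q oO cO posO bd0 cu uc sol fL _ _ _ _ _ _ _ _].
    by rewrite ltr_wpDl.
  apply: dimension_one => //; [exact: cvx_setP|exact: cvx_funP|].
  apply: alexandrov_monge_ampere_le L0 sol _ => x /fL/andP[lf ->].
  by rewrite (le_trans (ltW l0) lf).
pose beta : R := n.+1%:R + 3 + (alpha / 2)^-1.
have beta2 : 2 <= beta.
  have : 0 <= (n.+1%:R : R) by rewrite ler0n.
  have : 0 < (alpha / 2)^-1 by rewrite invr_gt0.
  by rewrite /beta; lra.
exists beta^-1 => [|lambda Lam M kappa K rho l0 lL k0 rho0].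
  by rewrite invr_gt0 (lt_le_trans _ beta2).
have L0 : 0 <= Lam := le_trans (ltW l0) lL.
(* [M1] dominates 1, M and 1 + M^2. As k |x|^2 <= x_n on the boundary, x_n < tau forces both |x| <
   rho and |x| <= 1, so smallness can be measured by height alone. *)
pose k := Num.min kappa 1; pose M1 := (1 + `|M|) ^+ 2.
pose tau := k * Num.min (rho ^+ 2) 1.
have k_gt0 : 0 < k by rewrite lt_min k0 ltr01.
have k_le1 : k <= 1 by rewrite ge_min lexx orbT.
have k_le : k <= kappa by rewrite ge_min lexx.
have tau_gt0 : 0 < tau by rewrite mulr_gt0 // lt_min ltr01 exprn_gt0.
have tau_le : tau <= k by rewrite ler_piMr ?(ltW k_gt0) // ge_min lexx orbT.
have tau_rho : tau <= k * rho ^+ 2 by rewrite ler_pM2l // ge_min lexx.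
have M11 : 1 <= M1 by rewrite exprn_ege1 // lerDl.
have M10 : 0 < M1 := lt_le_trans ltr01 M11.
have M1M : M <= M1.
  rewrite /M1; have := sqr_ge0 `|M|; have := normr_ge0 M; have := ler_norm M; nra.
have M1MM : 1 + M ^+ 2 <= M1.
  have e : `|M| ^+ 2 = M ^+ 2 by rewrite real_normK // num_real.
  by rewrite /M1 -e; have := normr_ge0 M; nra.
clearbody tau M1 k.
have N0 : 0 < tilted_bound k tau M1 `|K| Lam.
  by rewrite /tilted_bound !mulr_gt0 // ltr_pwDl.
have [cs cs0 gt] := growth_threshold_ex n.+1 k_gt0
  (mulr_gt0 (ltr0n _ 2) M10) N0 L0 tau_gt0 th0.
rewrite -/beta in gt; clearbody beta.
(* C is fixed before any domain is given, when K may still be negative; the absolute value keeps C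
   positive. *)
exists (growth_constant k tau M1 `|K| Lam beta cs).
  exact: growth_constant_gt0.
move=> Omega u f phi p q oO cO posO bd0 cu uc sol fL uphi kO phiK qp qq Hq Hp Mmax.
have [gM /andP[hpM hqM]] : enorm (pgrad p 0) <= M /\
    (opnorm (phess p 0) <= M) && (opnorm (phess q 0) <= M).
  move: Mmax; rewrite 2!ge_max => /andP[h1 /andP[h2 h3]].
  split; first exact: h1.
  apply/andP; split; [exact: h2|exact: h3].
have xp0 : xprime (0 : 'rV[R]_n.+2) = 0 by apply/rowP => i; rewrite !mxE.
have en0 j : enorm (0 : 'rV[R]_j) = 0 by rewrite /enorm dotv0l sqrtr0.
have kO1 x : boundary Omega x -> k * dotv x x <= xlast x.
  move=> /kO; rewrite enormE; apply: le_trans.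
  by rewrite ler_wpM2r ?dotv_ge0.
have near0 x : boundary Omega x -> xlast x < tau -> enorm x < rho.
  move=> /kO1 kx xt; rewrite -(ltr_pXn2r (n := 2)) ?nnegrE ?enorm_ge0 ?(ltW rho0) //.
  by rewrite enormE -(ltr_pM2l k_gt0); apply: lt_le_trans tau_rho; exact: le_lt_trans xt.
have z0 : 0 `^ (2 + alpha) = 0 :> R by rewrite powR0 // gt_eqF // addr_gt0.
(* The pinching at the origin itself has zero error, which identifies the constant terms of p and
   q. *)
have p0 : peval p 0 = u 0.
  have := Hp 0 bd0; rewrite xp0 !en0 z0 mulr0 => /(_ rho0).
  by rewrite normr_le0 subr_eq0 uphi // => /eqP.
have q0 : peval q 0 = 0.
  have := Hq 0 bd0; rewrite xp0 !en0 z0 mulr0 => /(_ rho0).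
  by rewrite /xlast mxE sub0r normrN normr_le0 => /eqP.
pose quad (r : mpoly n.+1 R) (y : 'rV[R]_n.+1) := dotv y (y *m phess r 0) / 2.
have quadZ r t y : quad r (t *: y) = t ^+ 2 * quad r y.
  by rewrite /quad -scalemxAl dotvZl dotvZr; ring.
have quadM r y : opnorm (phess r 0) <= M -> `|quad r y| <= M1 * dotv y y.
  move=> rM; apply: le_trans (normr_half_dotv_mul_le y rM) _.
  by apply: ler_wpM2r M1MM; exact: dotv_ge0.
have err (y : 'rV[R]_n.+1) : M * enorm y `^ (2 + alpha) <=
    M1 * (dotv y y * dotv y y `^ (alpha / 2)).
  by rewrite enorm_powR // ler_wpM2r // mulr_ge0 ?dotv_ge0 ?powR_ge0.
apply: (@pointwise_estimate R n.+1 k tau M1 `|K| Lam (alpha / 2) beta cs _ k_gt0 k_le1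
  tau_gt0 tau_le M11 L0 th0 beta2 cs0 Omega u (pgrad q 0) (pgrad p 0) (quad q) (quad p))
  => //.
- exact: cvx_setP.
- exact: cvx_funP.
- apply: alexandrov_monge_ampere_le L0 sol _ => x /fL/andP[lf ->].
  by rewrite (le_trans (ltW l0) lf).
- by move=> x bx; rewrite uphi //; apply: le_trans (phiK _ bx) (ler_norm _).
- by move=> y; exact: quadM.
- by move=> y; exact: quadM.
- rewrite -enormE; apply: (@le_trans _ _ (M ^+ 2)).
    by rewrite lerXn2r // nnegrE ?enorm_ge0 // (le_trans (enorm_ge0 _) gM).
  by apply: le_trans M1MM; rewrite lerDr ler01.
- move=> x bx xt; apply: le_trans (err _).
  by have := Hq _ bx (near0 _ bx xt); rewrite quadratic_taylor2 // q0 add0r.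
- move=> x bx xt; apply: le_trans (err _).
  have -> : u x - (u 0 + dotv (pgrad p 0) (xprime x) + quad p (xprime x)) =
      phi x - peval p (xprime x).
    by rewrite (quadratic_taylor2 qp) p0 (uphi _ bx).
  exact: Hp (near0 _ bx xt).
Qed.
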